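(* Let $\mathcal{H}$ be a separable infinite-dimensional Hilbert space and let $\{f_n\}_{n=0}^{\infty}\subseteq \mathcal{H}$ be a sequence with analysis operator $A_{f_n}$. The following are equivalent: (1) $\{f_n\}_{n=0}^{\infty}$ is a CFC sequence. (2) $\operatorname{Im}(A_{f_n})\subseteq \ell^2(\mathbb{N})$ contains an infinite-dimensional closed subspace (of $\ell^2(\mathbb{N})$). (3) There is an infinite-dimensional (not necessarily closed) subspace $D\subseteq \mathcal{H}$ and a constant $A>0$ such that $$A\|f\|^2\le \sum_{n=0}^{\infty}|\langle f,f_n\rangle|^2<\infty\quad\text{for all } f\in D.$$ Furthermore: (a) If (3) holds with a subspace $D$ that is closed, then $\{f_n\}$ is an SCFC sequence. Conversely, if $\{f_n\}$ is an SCFC sequence, then $D$ in (3) may be chosen to be closed. (b) If (3) holds with a subspace $D$ satisfying $\overline{D}=\mathcal{H}$, then $\{f_n\}$ is an ICFC sequence. Conversely, if $\{f_n\}$ is an ICFC sequence, then $D$ in (3) may be chosen so that $\overline{D}=\mathcal{H}$. (c) If (3) holds with a subspace $D$, then there exist a closed subspace $C$ of $\ell^2(\mathbb{N})$ and a bounded operator $T\in B(C,\mathcal{H})$ such that $(TT^* )^{1/2}f_n\in\overline{D}$ for all $n$ and $\{(TT^* )^{1/2}f_n\}_{n=0}^\infty$ is a Parseval frame in $\overline{D}$.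
   Context: A sequence $\{h_n\}$ in a Hilbert space $K$ is a Parseval frame in $K$ if $\|f\|^2=\sum_n|\langle f,h_n\rangle|^2$ for all $f\in K$. The (possibly unbounded) analysis operator of $\{f_n\}_{n=0}^\infty\subseteq\mathcal{H}$ is $A_{f_n}:\operatorname{dom}(A_{f_n})\to\ell^2(\mathbb{N})$, $A_{f_n}(f)=\{\langle f,f_n\rangle\}_{n=0}^\infty$, with $\operatorname{dom}(A_{f_n})=\{f\in\mathcal{H}:\{\langle f,f_n\rangle\}_{n=0}^\infty\in\ell^2(\mathbb{N})\}$. Here sequences in $\ell^2(\mathbb{N})$ are indexed from $n=0$. A sequence $\{f_n\}_{n=0}^\infty\subseteq\mathcal{H}$ is a CFC (continuously frame-convertible) sequence if there is $B\in B(\mathcal{H})$ (a bounded linear operator on $\mathcal{H}$) such that $\{Bf_n\}$ is a Parseval frame in $\mathcal{H}$. It is an ICFC (respectively SCFC) sequence if such a $B$ can be chosen injective (respectively surjective). *)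

(* Defs.v *)
From HB Require Import structures.
From mathcomp Require Import all_boot all_order all_algebra.
From mathcomp Require Import complex.
From mathcomp Require Import all_classical all_reals.
From mathcomp Require Import ereal topology normedtype sequences.
From mathcomp Require Import ring lra.

Set Implicit Arguments.
Unset Strict Implicit.
Unset Printing Implicit Defensive.

Import Order.TTheory GRing.Theory Num.Theory.
Import numFieldNormedType.Exports.

Local Open Scope classical_set_scope.
Local Open Scope ring_scope.

(* Scalars are either R or R[i], so that real and complex Hilbert spaces are
   treated at once. The norm of a normed module over [scalar R k] takes its
   values in the nonnegative elements of [scalar R k] (for R[i], complex numbers
   with zero imaginary part); [rnorm] is the same norm read in R, and applied
   to a scalar it is the modulus. *)
Variant scalar_kind := RealScalars | ComplexScalars.

Definition scalar (R : realType) (k : scalar_kind) : numFieldType :=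
  match k with RealScalars => R | ComplexScalars => R[i] end.

Definition conjs {R : realType} {k : scalar_kind} : scalar R k -> scalar R k :=
  match k with RealScalars => idfun | ComplexScalars => @Num.conj R[i] end.

Definition res {R : realType} {k : scalar_kind} : scalar R k -> R :=
  match k with RealScalars => idfun | ComplexScalars => @complex.Re R end.

Definition reals {R : realType} {k : scalar_kind} : R -> scalar R k :=
  match k with RealScalars => idfun | ComplexScalars => real_complex R end.

Definition rnorm {R : realType} {k : scalar_kind}
  {V : normedZmodType (scalar R k)} (x : V) : R := res `|x|.

Section ScalarTheory.
Variables (R : realType) (k : scalar_kind).
Local Notation K := (scalar R k).

Fact res_is_zmod_morphism : zmod_morphism (@res R k).
Proof. by case: k => // -[a b] [c d]. Qed.
HB.instance Definition _ :=
  GRing.isZmodMorphism.Build K R (@res R k) res_is_zmod_morphism.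

Fact reals_is_zmod_morphism : zmod_morphism (@reals R k).
Proof. by case: k => // a b; rewrite /reals rmorphB. Qed.
HB.instance Definition _ :=
  GRing.isZmodMorphism.Build R K (@reals R k) reals_is_zmod_morphism.

Fact reals_is_monoid_morphism : monoid_morphism (@reals R k).
Proof. by case: k; split => //= a b; rewrite /reals rmorphM. Qed.
HB.instance Definition _ :=
  GRing.isMonoidMorphism.Build R K (@reals R k) reals_is_monoid_morphism.

Fact conjs_is_zmod_morphism : zmod_morphism (@conjs R k).
Proof. by case: k => // a b; rewrite /conjs rmorphB. Qed.
HB.instance Definition _ :=
  GRing.isZmodMorphism.Build K K (@conjs R k) conjs_is_zmod_morphism.

Fact conjs_is_monoid_morphism : monoid_morphism (@conjs R k).
Proof.
by case: k; split => //=; rewrite /conjs ?rmorph1// => a b; rewrite rmorphM.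
Qed.
HB.instance Definition _ :=
  GRing.isMonoidMorphism.Build K K (@conjs R k) conjs_is_monoid_morphism.

Lemma conjsK : involutive (@conjs R k).
Proof. by case: k => // x; exact: conjCK. Qed.

Lemma realsK : cancel (@reals R k) res.
Proof. by case: k. Qed.

Lemma resK (x : K) : 0 <= x -> reals (res x) = x.
Proof.
by move: x; rewrite /scalar/reals/res; case: k => // x; 
  rewrite lecE => /andP[/eqP]; case: x => a b /= ->.
Qed.

Lemma ler_reals : {mono (@reals R k) : x y / x <= y}.
Proof. by case: k => // a b; rewrite /reals lecR. Qed.

Lemma ltr_reals : {mono (@reals R k) : x y / x < y}.
Proof. by case: k => // a b; rewrite /reals ltcR. Qed.

Lemma mul_conjs (x : K) : x * conjs x = `|x| ^+ 2.
Proof.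
move: x; case: k => x; last by rewrite -normCK.
by rewrite -expr2 real_normK ?num_real.
Qed.

Lemma normr_conjs (x : K) : `|conjs x| = `|x|.
Proof. by move: x; case: k => // x; rewrite norm_conjC. Qed.

Section RNorm.
Variable V : normedZmodType K.
Implicit Types x y : V.

Lemma reals_rnorm x : reals (rnorm x) = `|x|.
Proof. by rewrite /rnorm resK. Qed.

Lemma rnorm_ge0 x : 0 <= rnorm x.
Proof. by rewrite -ler_reals reals_rnorm rmorph0. Qed.

Lemma rnorm_leD x y : rnorm (x + y) <= rnorm x + rnorm y.
Proof. by rewrite -ler_reals rmorphD/= !reals_rnorm ler_normD. Qed.

Lemma rnorm0 : rnorm (0 : V) = 0.
Proof. by rewrite /rnorm normr0 raddf0. Qed.

Lemma rnorm0_eq0 x : rnorm x = 0 -> x = 0.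
Proof.
by move=> x0; apply/eqP; rewrite -normr_eq0 -reals_rnorm x0 rmorph0.
Qed.

Lemma rnormN x : rnorm (- x) = rnorm x.
Proof. by rewrite /rnorm normrN. Qed.

End RNorm.

Lemma rnormM (x y : K) : rnorm (x * y) = rnorm x * rnorm y.
Proof.
by apply: (can_inj realsK); rewrite rmorphM/= !reals_rnorm normrM.
Qed.

Lemma rnorm_conjs (x : K) : rnorm (conjs x) = rnorm x.
Proof. by rewrite /rnorm normr_conjs. Qed.

Lemma rnormZ (V : normedModType K) (a : K) (x : V) :
  rnorm (a *: x) = rnorm a * rnorm x.
Proof.
by apply: (can_inj realsK); rewrite rmorphM/= !reals_rnorm normrZ.
Qed.

End ScalarTheory.

(* Inner products are linear in the first argument and conjugate-linear in the
   second one. *)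
HB.mixin Record NormedModule_hasDot (R : realType) (k : scalar_kind) V
    & NormedModule (scalar R k) V := {
  dotv : V -> V -> scalar R k;
  dotv_linearl : forall y : V, linear_for *%R (dotv ^~ y);
  dotv_conj : forall x y : V, dotv x y = conjs (dotv y x);
  dotvv : forall x : V, dotv x x = `|x| ^+ 2
}.

#[short(type="preHilbertType")]
HB.structure Definition PreHilbert (R : realType) (k : scalar_kind) :=
  {V of NormedModule (scalar R k) V & NormedModule_hasDot R k V}.

#[short(type="hilbertType")]
HB.structure Definition Hilbert (R : realType) (k : scalar_kind) :=
  {V of PreHilbert R k V & Complete V}.

Section DotInstance.
Variables (R : realType) (k : scalar_kind) (V : preHilbertType R k).

Fact dotv_is_bilinear :
  bilinear_for *%R (@conjs R k \; *%R) (@dotv R k V).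
Proof.
split=> [y|x]; first exact: dotv_linearl.
move=> a y z; rewrite dotv_conj dotv_linearl rmorphD rmorphM/=.
by rewrite -!dotv_conj.
Qed.
HB.instance Definition _ := @bilinear_isBilinear.Build (scalar R k) V V
  (scalar R k) *%R (@conjs R k \; *%R) (@dotv R k V) dotv_is_bilinear.

Fact dotv_is_hermitian (x y : V) :
  dotv x y = (-1) ^+ false * conjs (dotv y x).
Proof. by rewrite expr0 mul1r -dotv_conj. Qed.
HB.instance Definition _ := @isHermitianSesquilinear.Build (scalar R k) V
  false (@conjs R k) (@dotv R k V) dotv_is_hermitian.

Fact dotv_gt0 (x : V) : x != 0 -> 0 < dotv x x.
Proof. by move=> x0; rewrite dotvv exprn_gt0// normr_gt0. Qed.
HB.instance Definition _ := @isDotProduct.Build (scalar R k) V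
  (@dotv R k V) dotv_gt0.

End DotInstance.


Section ScalarComplete.
Variable R : realType.

Local Notation C := (scalar R ComplexScalars).

Lemma complex_cauchy_cvg (F : set_system C) :
  ProperFilter F -> cauchy F -> cvg F.
Proof.
move=> FF /cauchy_ballP Fc.
have part (p : C -> R) : (forall z w : C, reals `|p z - p w| <= `|z - w|) ->
    cvg (p @ F).
  move=> pL; apply/cauchy_cvgP/cauchy_ballP => e e0.
  have /Fc : (0 : C) < reals e by rewrite ltcR.
  move=> Fe; rewrite near_map2; move: Fe.
  apply: filterS => -[z w] /=; rewrite -!ball_normE/= => zw; rewrite -ltcR.
  by apply: le_lt_trans zw; exact: pL.
have hRe (z w : C) : reals `|complex.Re z - complex.Re w| <= `|z - w|.
  by rewrite -raddfB; exact: normc_ge_Re.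
have /cvg_ex[a Fa] := part _ hRe.
have hIm (z w : C) : reals `|complex.Im z - complex.Im w| <= `|z - w|.
  rewrite -raddfB; case: (z - w) => c d /=.
  rewrite normc_def lecR -sqrtr_sqr ler_wsqrtr//.
  by rewrite lerDr sqr_ge0.
have /cvg_ex[b Fb] := part _ hIm.
apply/cvg_ex; exists (Complex a b : C).
apply/cvgrPdist_lt => e; case: e => e e'; rewrite ltcE/= => /andP[/eqP -> e0].
have e2 : 0 < e / 2 by rewrite divr_gt0.
move/cvgrPdist_lt : Fa => /(_ _ e2) Fa.
move/cvgrPdist_lt : Fb => /(_ _ e2) Fb.
near=> z.
have Fa1 : `|a - complex.Re z| < e / 2 by near: z.
have Fb1 : `|b - complex.Im z| < e / 2 by near: z.
rewrite normc_def ltcR !raddfB/=.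
move: (complex.Re z) (complex.Im z) Fa1 Fb1 => c d Fa1 Fb1.
apply: (@le_lt_trans _ _ (`|a - c| + `|b - d|)); last first.
  by rewrite (splitr e) ltrD.
rewrite -[leRHS]ger0_norm ?addr_ge0// -sqrtr_sqr ler_wsqrtr//.
rewrite [leRHS]sqrrD !real_normK ?num_real//.
by rewrite -addrA [X in _ <= _ + X]addrC addrA lerDl mulrn_wge0// mulr_ge0.
Unshelve. all: by end_near. Qed.

Variable k : scalar_kind.
Local Notation K := (scalar R k).

Lemma scalar_cauchy_cvg (F : set_system K) :
  ProperFilter F -> cauchy F -> cvg F.
Proof.
move: F; case: k => F FF; first exact: R_complete.
exact: complex_cauchy_cvg.
Qed.

Lemma normr_reals (x : R) : `|reals x : K| = reals `|x|.
Proof.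
case: k => //.
by rewrite /reals normc_def/= expr0n/= addr0 sqrtr_sqr.
Qed.

Lemma cvg_reals (T : Type) (F : set_system T) {FF : Filter F}
    (u : T -> R) (l : R) :
  u @ F --> l -> (reals (u t) : K) @[t --> F] --> (reals l : K).
Proof.
move=> /cvgrPdist_lt ul; apply/cvgrPdist_lt => e e0.
have re0 : 0 < res e by rewrite -(ltr_reals k) rmorph0 resK// ltW.
apply: filterS (ul _ re0) => t.
by rewrite -(ltr_reals k) resK ?ltW// -rmorphB/= normr_reals.
Qed.

Lemma cvg_conjs (T : Type) (F : set_system T) {FF : Filter F}
    (u : T -> K) (l : K) :
  u @ F --> l -> conjs (u t) @[t --> F] --> (conjs l : K).
Proof.
move=> /cvgrPdist_lt ul; apply/cvgrPdist_lt => e e0.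
by apply: filterS (ul _ e0) => t; rewrite -rmorphB/= normr_conjs.
Qed.

Lemma cvg_rnorm (V : normedModType K) (T : Type) (F : set_system T)
    {FF : Filter F} (u : T -> V) (l : V) :
  u @ F --> l -> rnorm (u t) @[t --> F] --> rnorm l.
Proof.
move=> /cvgrPdist_lt ul; apply/cvgrPdist_lt => e e0.
have re0 : (0 : K) < reals e by rewrite -[0](rmorph0 reals) ltr_reals.
apply: filterS (ul _ re0) => t.
rewrite -reals_rnorm ltr_reals; apply: le_lt_trans.
rewrite ler_norml; apply/andP; split.
  rewrite lerNl opprB lerBlDr -[rnorm (l - u t)]rnormN opprB.
  by rewrite -[in leLHS](subrK l (u t)) rnorm_leD.
by rewrite lerBlDr -[in leLHS](subrK (u t) l) rnorm_leD.
Qed.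

Lemma cvgn_series_rnorm (u : K ^nat) :
  cvgn (series (fun n => rnorm (u n))) -> cvgn (series u).
Proof.
move=> /cauchy_cvgP/cauchy_seriesP uc.
apply: scalar_cauchy_cvg; apply/cauchy_seriesP => e e0.
have re0 : 0 < res e by rewrite -(ltr_reals k) rmorph0 resK// ltW.
apply: filterS (uc _ re0) => -[m n] /=.
rewrite -(ltr_reals k) resK ?ltW//; apply: le_lt_trans.
rewrite (@ger0_norm R); last by apply: sumr_ge0 => i _; exact: rnorm_ge0.
rewrite rmorph_sum; apply: (le_trans (ler_norm_sum _ _ _)).
by apply: ler_sum => i _; rewrite /= reals_rnorm.
Qed.

End ScalarComplete.

Definition sqsum {R : realType} {k : scalar_kind} (a : nat -> scalar R k) :
  \bar R := (\sum_(0 <= n <oo) (rnorm (a n) ^+ 2)%:E)%E.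

Definition square_summable {R : realType} {k : scalar_kind}
  (a : nat -> scalar R k) : Prop := (sqsum a < +oo)%E.

Section SquareSums.
Variables (R : realType) (k : scalar_kind).
Local Notation K := (scalar R k).
Implicit Types a b : nat -> K.

Local Notation psum a n := (\sum_(0 <= i < n) rnorm (a i) ^+ 2).

Lemma psum_ge0 a n : 0 <= psum a n.
Proof. by apply: sumr_ge0 => i _; rewrite sqr_ge0. Qed.

Lemma sqsum_ge0 a : (0 <= sqsum a)%E.
Proof. by apply: nneseries_ge0 => n _ _; rewrite lee_fin sqr_ge0. Qed.

Lemma psum_le_sqsum a n : ((psum a n)%:E <= sqsum a)%E.
Proof.
rewrite -sumEFin; apply: nneseries_lim_ge => i _ _.
by rewrite lee_fin sqr_ge0.
Qed.

Lemma sqsum_leP a (M : R) :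
  (sqsum a <= M%:E)%E <-> forall n, psum a n <= M.
Proof.
split=> [aM n|aM].
  by rewrite -lee_fin; apply: le_trans aM; exact: psum_le_sqsum.
apply: lime_le.
  by apply: is_cvg_nneseries => n _ _; rewrite lee_fin sqr_ge0.
by apply: nearW => n; rewrite sumEFin lee_fin.
Qed.

Lemma square_summableP a :
  square_summable a <-> exists M, forall n, psum a n <= M.
Proof.
split=> [|[M /sqsum_leP aM]]; last exact: le_lt_trans (ltry M).
rewrite /square_summable => afin; exists (fine (sqsum a)); apply/sqsum_leP.
by rewrite fineK// ge0_fin_numE// sqsum_ge0.
Qed.

Definition sqnorm a : R := Num.sqrt (fine (sqsum a)).

Lemma sqnorm_ge0 a : 0 <= sqnorm a. Proof. exact: sqrtr_ge0. Qed.

Lemma sqsumE a : square_summable a -> sqsum a = (sqnorm a ^+ 2)%:E.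
Proof.
move=> afin; rewrite sqr_sqrtr ?fine_ge0 ?sqsum_ge0//.
by rewrite fineK// ge0_fin_numE// sqsum_ge0.
Qed.

Lemma psum_le_sqnorm a n : square_summable a -> psum a n <= sqnorm a ^+ 2.
Proof. by move=> /sqsumE aE; move: n; apply/sqsum_leP; rewrite aE. Qed.

Lemma sqnorm_le a M : 0 <= M -> (forall n, psum a n <= M ^+ 2) ->
  sqnorm a <= M.
Proof.
move=> M0 aM; have a_fin : square_summable a by apply/square_summableP; exists (M ^+ 2).
rewrite -(@ler_pXn2r _ 2)// ?nnegrE ?sqnorm_ge0//.
by rewrite -lee_fin -sqsumE//; apply/sqsum_leP => n; exact: aM.
Qed.

Lemma minkowski_step (p q r x y z : R) : 0 <= p -> 0 <= q -> 0 <= r ->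
  0 <= x -> 0 <= y -> 0 <= z -> p <= q + r -> x <= y + z ->
  Num.sqrt (p ^+ 2 + x ^+ 2) <=
  Num.sqrt (q ^+ 2 + y ^+ 2) + Num.sqrt (r ^+ 2 + z ^+ 2).
Proof.
move=> p0 q0 r0 x0 y0 z0 pqr xyz.
set s := Num.sqrt _; set t := Num.sqrt _; set u := Num.sqrt _.
have s0 : 0 <= s by exact: sqrtr_ge0.
have t0 : 0 <= t by exact: sqrtr_ge0.
have u0 : 0 <= u by exact: sqrtr_ge0.
have s2 : s ^+ 2 = p ^+ 2 + x ^+ 2 by rewrite sqr_sqrtr// addr_ge0 ?sqr_ge0.
have t2 : t ^+ 2 = q ^+ 2 + y ^+ 2 by rewrite sqr_sqrtr// addr_ge0 ?sqr_ge0.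
have u2 : u ^+ 2 = r ^+ 2 + z ^+ 2 by rewrite sqr_sqrtr// addr_ge0 ?sqr_ge0.
have tu : q * r + y * z <= t * u.
  rewrite -(@ler_pXn2r _ 2)// ?nnegrE ?addr_ge0 ?mulr_ge0//.
  rewrite exprMn t2 u2 -subr_ge0.
  have -> : (q ^+ 2 + y ^+ 2) * (r ^+ 2 + z ^+ 2) - (q * r + y * z) ^+ 2 =
            (q * z - y * r) ^+ 2 by ring.
  exact: sqr_ge0.
rewrite -(@ler_pXn2r _ 2)// ?nnegrE ?addr_ge0//.
rewrite sqrrD s2 t2 u2.
have pp : p ^+ 2 <= (q + r) ^+ 2 by rewrite ler_pXn2r// nnegrE addr_ge0.
have xx : x ^+ 2 <= (y + z) ^+ 2 by rewrite ler_pXn2r// nnegrE addr_ge0.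
by move: pp xx tu; lra.
Qed.

Lemma psum_minkowski a b n :
  Num.sqrt (psum (fun i => a i + b i) n) <=
  Num.sqrt (psum a n) + Num.sqrt (psum b n).
Proof.
elim: n => [|n IHn]; first by rewrite !big_geq// sqrtr0 addr0.
have psumS (c : nat -> K) : psum c n.+1 = Num.sqrt (psum c n) ^+ 2 + rnorm (c n) ^+ 2.
  by rewrite big_nat_recr//= sqr_sqrtr ?psum_ge0.
rewrite (psumS a) (psumS b) (psumS (fun i => a i + b i)).
by apply: minkowski_step; rewrite ?sqrtr_ge0 ?rnorm_ge0 ?rnorm_leD.
Qed.

Lemma psumD_le a b n : square_summable a -> square_summable b ->
  psum (fun i => a i + b i) n <= (sqnorm a + sqnorm b) ^+ 2.
Proof.
move=> ha hb; rewrite -[leLHS]sqr_sqrtr ?psum_ge0//.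
rewrite ler_pXn2r// ?nnegrE ?addr_ge0 ?sqnorm_ge0 ?sqrtr_ge0//.
apply: le_trans (psum_minkowski a b n) _; apply: lerD.
  rewrite -[leRHS]ger0_norm ?sqnorm_ge0// -sqrtr_sqr ler_wsqrtr//.
  exact: psum_le_sqnorm.
rewrite -[leRHS]ger0_norm ?sqnorm_ge0// -sqrtr_sqr ler_wsqrtr//.
exact: psum_le_sqnorm.
Qed.

Lemma psumZ (c : K) a n :
  psum (fun i => c * a i) n = rnorm c ^+ 2 * psum a n.
Proof. by rewrite mulr_sumr; apply: eq_bigr => i _; rewrite rnormM exprMn. Qed.

Lemma square_summable0 : square_summable (fun=> 0 : K).
Proof.
apply/square_summableP; exists 0 => n.
by rewrite big1// => i _; rewrite rnorm0 expr0n.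
Qed.

Lemma square_summableD a b : square_summable a -> square_summable b ->
  square_summable (fun i => a i + b i).
Proof.
move=> ha hb; apply/square_summableP.
by exists ((sqnorm a + sqnorm b) ^+ 2) => n; exact: psumD_le.
Qed.

Lemma square_summableZ (c : K) a : square_summable a ->
  square_summable (fun i => c * a i).
Proof.
move=> /square_summableP[M aM]; apply/square_summableP.
by exists (rnorm c ^+ 2 * M) => n; rewrite psumZ ler_wpM2l ?sqr_ge0.
Qed.

Lemma sqnormD a b : square_summable a -> square_summable b ->
  sqnorm (fun i => a i + b i) <= sqnorm a + sqnorm b.
Proof.
move=> ha hb; apply: sqnorm_le; first by rewrite addr_ge0 ?sqnorm_ge0.
by move=> n; exact: psumD_le.
Qed.

Lemma sqnormZ_le (c : K) a : square_summable a ->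
  sqnorm (fun i => c * a i) <= rnorm c * sqnorm a.
Proof.
move=> ha; apply: sqnorm_le; first by rewrite mulr_ge0 ?rnorm_ge0 ?sqnorm_ge0.
by move=> n; rewrite psumZ exprMn ler_wpM2l ?sqr_ge0// psum_le_sqnorm.
Qed.

Lemma sqnorm_eq0 a : square_summable a -> sqnorm a = 0 -> forall n, a n = 0.
Proof.
move=> ha a0 n; apply: rnorm0_eq0; apply/eqP; rewrite -sqrf_eq0 eq_le sqr_ge0.
rewrite andbT; have := psum_le_sqnorm n.+1 ha.
rewrite a0 expr0n big_nat_recr//=; apply: le_trans.
by rewrite lerDr psum_ge0.
Qed.

Lemma sqnormZ (c : K) a : square_summable a ->
  sqnorm (fun i => c * a i) = rnorm c * sqnorm a.
Proof.
move=> ha; apply/eqP; rewrite eq_le sqnormZ_le//=.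
have [->|c0] := eqVneq c 0; first by rewrite rnorm0 mul0r sqnorm_ge0.
have rc0 : 0 < rnorm c.
  rewrite lt_neqAle rnorm_ge0 andbT eq_sym; apply: contra_neq c0.
  exact: rnorm0_eq0.
have := sqnormZ_le c^-1 (square_summableZ c ha).
under [in sqnorm _]eq_fun do rewrite mulKf//.
have -> : rnorm c^-1 = (rnorm c)^-1.
  apply: (mulfI (lt0r_neq0 rc0)); rewrite -rnormM !mulfV ?(lt0r_neq0 rc0)//.
  by rewrite /rnorm normr1 -(rmorph1 (@reals R k)) realsK.
by rewrite ler_pdivlMl.
Qed.

Lemma cvg_psum a : square_summable a ->
  psum a n @[n --> \oo] --> sqnorm a ^+ 2.
Proof.
move=> ha; apply: (@fine_cvg _ _ _ _ (fun n => (psum a n)%:E)).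
rewrite -sqsumE//; under eq_fun do rewrite -sumEFin.
by apply: is_cvg_nneseries => n _ _; rewrite lee_fin sqr_ge0.
Qed.

End SquareSums.

(* The regular module [_^o] only serves to inherit the pointwise module
   structure of functions; [l2_seq] forgets it. *)
Definition l2_pred (R : realType) (k : scalar_kind) :
  {pred nat -> (scalar R k)^o} := fun a => `[< square_summable a >].

Record l2 (R : realType) (k : scalar_kind) := L2 {
  l2_val : nat -> (scalar R k)^o;
  l2_subproof : l2_val \in @l2_pred R k
}.

Definition l2_seq (R : realType) (k : scalar_kind) (a : l2 R k) :
  nat -> scalar R k := l2_val a.
Coercion l2_seq : l2 >-> Funclass.

Section L2Module.
Variables (R : realType) (k : scalar_kind).
Local Notation K := (scalar R k).

HB.instance Definition _ := [isSub for @l2_val R k].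
HB.instance Definition _ := [Choice of l2 R k by <:].

Fact l2_submod_closed : submod_closed (@l2_pred R k).
Proof.
split; first by apply/asboolP; exact: square_summable0.
move=> c a b /asboolP ha /asboolP hb; apply/asboolP.
exact: (square_summableD (square_summableZ c ha) hb).
Qed.
HB.instance Definition _ :=
  GRing.isSubmodClosed.Build _ _ (@l2_pred R k) l2_submod_closed.
HB.instance Definition _ := [SubChoice_isSubLmodule of l2 R k by <:].

Implicit Types a b : l2 R k.

Lemma l2P a : square_summable a.
Proof. exact/asboolP/l2_subproof. Qed.

Lemma l2_addE a b n : (a + b) n = a n + b n. Proof. by []. Qed.
Lemma l2_oppE a n : (- a) n = - a n. Proof. by []. Qed.
Lemma l2_scaleE (c : K) a n : (c *: a) n = c * a n. Proof. by []. Qed.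
Lemma l2_ext a b : (forall n, a n = b n) -> a = b.
Proof. by move=> ab; apply/val_inj/funext. Qed.

Definition l2_norm a : K := reals (sqnorm a).

Fact l2_ler_normD a b : l2_norm (a + b) <= l2_norm a + l2_norm b.
Proof.
rewrite /l2_norm -rmorphD ler_reals.
exact: sqnormD (l2P a) (l2P b).
Qed.

Fact l2_normrZ (c : K) a : l2_norm (c *: a) = `|c| * l2_norm a.
Proof.
by rewrite /l2_norm -reals_rnorm -rmorphM/= -(sqnormZ c (l2P a)).
Qed.

Fact l2_normr0_eq0 a : l2_norm a = 0 -> a = 0.
Proof.
rewrite /l2_norm -(rmorph0 reals) => /(can_inj (@realsK R k)) a0.
exact/l2_ext/(sqnorm_eq0 (l2P a)).
Qed.

HB.instance Definition _ := @Lmodule_isNormed.Build K (l2 R k) l2_norm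
  l2_ler_normD l2_normrZ l2_normr0_eq0.

Lemma l2_normE a : `|a| = reals (sqnorm a). Proof. by []. Qed.

Lemma l2_rnormE a : rnorm a = sqnorm a.
Proof. by rewrite /rnorm l2_normE realsK. Qed.

Definition l2_dot a b : K := limn (series (fun n => a n * conjs (b n))).

Lemma is_cvg_l2_dot a b : cvgn (series (fun n => (a n : K) * conjs (b n))).
Proof.
apply: cvgn_series_rnorm.
have nd : nondecreasing_seq
    (series (fun n => rnorm ((a n : K) * conjs (b n)))).
  move=> m n mn; rewrite -subr_ge0 sub_series_geq//.
  by apply: sumr_ge0 => i _; exact: rnorm_ge0.
apply: nondecreasing_is_cvgn => //.
exists (sqnorm a ^+ 2 + sqnorm b ^+ 2) => _ [n _ <-].
apply: (le_trans _ (lerD (psum_le_sqnorm n (l2P a)) (psum_le_sqnorm n (l2P b)))).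
rewrite /series/= -big_split/=; apply: ler_sum => i _.
rewrite rnormM rnorm_conjs.
have := sqr_ge0 (rnorm (a i) - rnorm (b i)); rewrite sqrrB.
have := mulr_ge0 (rnorm_ge0 (a i)) (rnorm_ge0 (b i)).
set x := rnorm (a i); set y := rnorm (b i); lra.
Qed.

Fact l2_dot_linearl b : linear_for *%R (l2_dot ^~ b).
Proof.
move=> c x y; apply/cvg_lim => //.
rewrite [X in X @ _](_ : _ = (fun n => c * series (fun n => x n * conjs (b n)) n
    + series (fun n => y n * conjs (b n)) n)).
  by apply: cvgD; [apply: cvgMr|]; exact: is_cvg_l2_dot.
apply/funext => n; rewrite /series/= mulr_sumr -big_split/=.
apply: eq_bigr => i _; rewrite -/((c *: x + y : l2 R k) i).
by transitivity ((c * x i + y i) * conjs (b i)); last rewrite mulrDl mulrA.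
Qed.

Fact l2_dot_conj a b : l2_dot a b = conjs (l2_dot b a).
Proof.
apply/cvg_lim => //.
rewrite [X in X @ _](_ : _ =
  (fun n => conjs (series (fun n => b n * conjs (a n)) n))).
  by apply: cvg_conjs; exact: is_cvg_l2_dot.
apply/funext => n; rewrite /series/= rmorph_sum/=.
by apply: eq_bigr => i _; rewrite rmorphM/= conjsK mulrC.
Qed.

Fact l2_dotvv a : l2_dot a a = `|a| ^+ 2.
Proof.
apply/cvg_lim => //; rewrite l2_normE -rmorphXn/=.
rewrite [X in X @ _](_ : _ =
  (fun n => reals (\sum_(0 <= i < n) rnorm (a i) ^+ 2))).
  by apply: cvg_reals; apply: cvg_psum; exact: l2P.
apply/funext => n; rewrite /series/= rmorph_sum/=.
by apply: eq_bigr => i _; rewrite rmorphXn/= reals_rnorm mul_conjs.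
Qed.

HB.instance Definition _ := @NormedModule_hasDot.Build R k (l2 R k) l2_dot
  l2_dot_linearl l2_dot_conj l2_dotvv.

Fact l2_cauchy_cvg (F : set_system (l2 R k)) :
  ProperFilter F -> cauchy F -> cvg F.
Proof.
move=> FF /cauchy_ballP Fc.
have rposK (e : R) : 0 < e -> (0 : K) < reals e.
  by move=> e0; rewrite -(rmorph0 reals) ltr_reals.
have coordC n : cvg ((fun a : l2 R k => a n : K) @ F).
  apply: scalar_cauchy_cvg; apply/cauchy_ballP => e e0.
  rewrite near_map2; move: (Fc e e0); apply: filterS => -[a b] /=.
  rewrite -!ball_normE/=; apply: le_lt_trans.
  rewrite l2_normE -reals_rnorm ler_reals.
  have := psum_le_sqnorm n.+1 (l2P (a - b)).
  rewrite big_nat_recr//= -{2}(ger0_norm (sqnorm_ge0 _)) => h.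
  rewrite -(@ler_pXn2r _ 2)// ?nnegrE ?rnorm_ge0 ?sqnorm_ge0//.
  by move: h; rewrite ger0_norm ?sqnorm_ge0//; apply: le_trans; rewrite lerDr psum_ge0.
pose x n : K := lim ((fun a : l2 R k => a n : K) @ F).
have key (e : R) : 0 < e -> \forall a \near F,
    let a : l2 R k := a in forall n, \sum_(0 <= i < n) rnorm (a i - x i) ^+ 2 <= e ^+ 2.
  move=> e0; have /nearP_dep := Fc _ (rposK _ e0).
  apply: filterS => a Fa /= n.
  have cv : (fun b : l2 R k => \sum_(0 <= i < n) rnorm (a i - b i) ^+ 2) @ F -->
      \sum_(0 <= i < n) rnorm (a i - x i) ^+ 2.
    elim: n => [|n IHn].
      by under eq_fun do rewrite big_geq//; rewrite big_geq//; exact: cvg_cst.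
    under eq_fun do rewrite big_nat_recr//=.
    rewrite big_nat_recr//=; apply: cvgD; first exact: IHn.
    have cr : (fun b : l2 R k => rnorm (a n - b n)) @ F --> rnorm (a n - x n).
      apply: (@cvg_rnorm R k K^o).
      by apply: cvgB; [exact: cvg_cst|exact: coordC].
    by rewrite expr2; under eq_fun do rewrite expr2; exact: cvgM.
  apply: (cvgr_to_le cv); apply: filterS Fa => b; rewrite -ball_normE/= l2_normE ltr_reals => ab.
  apply: (le_trans (psum_le_sqnorm n (l2P (a - b)))).
  by rewrite ler_pXn2r ?nnegrE ?sqnorm_ge0 ?ltW.
have xsq : square_summable x.
  have /filter_ex[a ha] := key _ ltr01.
  have hd : square_summable (fun i => a i - x i).
    by apply/square_summableP; exists (1 ^+ 2).
  have := square_summableD (l2P a) (square_summableZ (-1) hd).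
  by congr square_summable; apply/funext => i; rewrite mulN1r opprB addrC subrK.
apply/cvg_ex; exists (L2 (asboolT xsq)).
apply/cvgrPdistC_lt => e e0.
have re0 : 0 < res e by rewrite -(ltr_reals k) rmorph0 resK// ltW.
have e20 : 0 < res e / 2 by rewrite divr_gt0.
apply: filterS (key _ e20) => a ha.
rewrite l2_normE -[e]resK ?ltW// ltr_reals.
apply: (@le_lt_trans _ _ (res e / 2)); last by rewrite ltr_pdivrMr// ltr_pMr// ltr1n.
by apply: sqnorm_le; [exact: ltW|exact: ha].
Qed.

HB.instance Definition _ := Uniform_isComplete.Build (l2 R k) l2_cauchy_cvg.

End L2Module.

Section Subspaces.
Variables (R : realType) (k : scalar_kind) (V : normedModType (scalar R k)).

Definition linear_subspace (D : set V) : Prop :=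
  D 0 /\ forall (a : scalar R k) (x y : V), D x -> D y -> D (a *: x + y).

Definition finite_dim (D : set V) : Prop :=
  exists (n : nat) (e : 'I_n -> V), (forall i, D (e i)) /\
    forall x, D x -> exists c : 'I_n -> scalar R k, x = \sum_(i < n) c i *: e i.

Definition infinite_dim (D : set V) : Prop := ~ finite_dim D.

Definition separable : Prop := exists2 A : set V, countable A & dense A.

End Subspaces.

Arguments separable {R k} V.

Section Operators.
Variables (R : realType) (k : scalar_kind).

(* Operators on a subspace C are total functions whose values outside of C are
   irrelevant. *)
Definition linear_on (V W : normedModType (scalar R k)) (C : set V)
    (T : V -> W) : Prop :=
  forall (a : scalar R k) (x y : V), C x -> C y ->
    T (a *: x + y) = a *: T x + T y.

Definition bounded_on (V W : normedModType (scalar R k)) (C : set V)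
    (T : V -> W) : Prop :=
  exists M : R, forall x, C x -> rnorm (T x) <= M * rnorm x.

(* T' : W -> C is the adjoint of T : C -> W *)
Definition is_adjoint_on (V W : preHilbertType R k) (C : set V)
    (T : V -> W) (T' : W -> V) : Prop :=
  (forall y, C (T' y)) /\
  (forall x y, C x -> dotv (T x) y = dotv x (T' y)).

(* S = P^(1/2); self-adjointness is not implied by positivity over real
   scalars *)
Definition is_positive_sqrt (H : preHilbertType R k) (S : {linear H -> H})
    (P : H -> H) : Prop :=
  [/\ bounded_on [set: H] S,
      forall x y, dotv (S x) y = dotv x (S y),
      forall x, 0 <= dotv (S x) x
    & forall x, S (S x) = P x].

End Operators.

Section Frames.
Variables (R : realType) (k : scalar_kind) (H : hilbertType R k).
Implicit Types (f h : nat -> H) (D E : set H).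

Definition parseval_frame E h : Prop :=
  (forall n, E (h n)) /\
  forall x, E x -> (rnorm x ^+ 2)%:E = sqsum (fun n => dotv x (h n)).

Definition analysis_dom f : set H :=
  [set x | square_summable (fun n => dotv x (f n))].

Definition analysis f (x : H) (xf : analysis_dom f x) : l2 R k :=
  L2 (asboolT xf).

Definition analysis_range f : set (l2 R k) :=
  [set a | exists (x : H) (xf : analysis_dom f x), a = analysis xf].

Definition CFC f : Prop :=
  exists B : {linear H -> H},
    bounded_on [set: H] B /\ parseval_frame [set: H] (B \o f).

Definition ICFC f : Prop :=
  exists B : {linear H -> H}, [/\ bounded_on [set: H] B,
    parseval_frame [set: H] (B \o f) & injective B].

Definition SCFC f : Prop :=
  exists B : {linear H -> H}, [/\ bounded_on [set: H] B,
    parseval_frame [set: H] (B \o f) & forall y, exists x, B x = y].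

Definition has_lower_bound_on f D : Prop :=
  [/\ linear_subspace D, infinite_dim D &
    exists2 A : R, 0 < A & forall x, D x ->
      ((A * rnorm x ^+ 2)%:E <= sqsum (fun n => dotv x (f n)) < +oo)%E].

End Frames.

(* Main.v *)
From HB Require Import structures.
From mathcomp Require Import all_boot all_order all_algebra.
From mathcomp Require Import complex.
From mathcomp Require Import all_classical all_reals.
From mathcomp Require Import ereal topology normedtype sequences.
From mathcomp Require Import ring lra.
Require Import Defs.
Import Order.TTheory GRing.Theory Num.Theory.
Import numFieldNormedType.Exports.

(** Write [A] for the analysis operator, a closed operator from [H] to [l2].

    If [B f_n] is a Parseval frame then [A B'] is an isometry, where [B'] is the
    adjoint of [B]; hence [A] is bounded below on the range of [B']
    ([parseval_adjoint_range]). This range is dense when [B] is injective, and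
    closed when [B] is surjective ([closed_range_adjoint]).

    Conversely, let [A] be bounded below on [D]. The inverse of [A] on [D]
    extends to a bounded operator [T : l2 -> H] with values in the closure of
    [D], and [A T] is the identity on the closure of [A D]
    ([bounded_left_inverse]); this closure is the subspace required in the range
    of [A]. Let [S] be the positive square root of [T T'] ([positive_sqrt]).
    Since [|S z| = |T' z|] and [A S S z = T' z], the map [A S] is isometric on
    the closure of the range of [S], which is the closure of [D]; as [S] is
    self-adjoint, [S f_n] is a Parseval frame in the closure of [D]
    ([parseval_sqrt]). If [D] is dense, [S] is injective. In general the
    closure of [D] is infinite-dimensional, so there is an isometry [U] of the
    separable space [H] into it ([separable_embedding]), and [U' S] turns [f_n]
    into a Parseval frame of [H] ([lower_bound_CFC]). If [D] is closed, the
    range of [S] contains [D], and [U' S] is onto.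

    Finally, from a closed subspace [M] of the range of [A] one gets [D] as the
    part of its preimage orthogonal to the kernel of [A]; boundedness of the
    inverse [M -> D] is a case of the uniform boundedness principle
    ([closed_range_lower_bound]).

    Operators are constructed from their graphs: [riesz_relation] represents a
    bounded functional given as a linear relation, and [bounded_extension] turns
    a bounded linear relation between Hilbert spaces into an operator together
    with its adjoint. *)

Set Implicit Arguments.
Unset Strict Implicit.
Unset Printing Implicit Defensive.

Local Open Scope classical_set_scope.
Local Open Scope ring_scope.

(** * Inner products over both scalar fields *)

Section Basics.
Variables (R : realType) (k : scalar_kind) (V : preHilbertType R k).
Local Notation K := (scalar R k).
Implicit Types (x y z : V) (a c : K).

Lemma dotvDl x y z : dotv (x + y) z = dotv x z + dotv y z.
Proof. by have := dotv_linearl z 1 x y; rewrite scale1r mul1r. Qed.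

Lemma dotv0l z : dotv (0 : V) z = 0.
Proof. by apply: (addrI (dotv 0 z)); rewrite -dotvDl !addr0. Qed.

Lemma dotvZl a x z : dotv (a *: x) z = a * dotv x z.
Proof. by have := dotv_linearl z a x 0; rewrite dotv0l !addr0. Qed.

Lemma dotvNl x z : dotv (- x) z = - dotv x z.
Proof. by rewrite -scaleN1r dotvZl mulN1r. Qed.

Lemma dotvBl x y z : dotv (x - y) z = dotv x z - dotv y z.
Proof. by rewrite dotvDl dotvNl. Qed.

Lemma dotvDr x y z : dotv z (x + y) = dotv z x + dotv z y.
Proof. by rewrite dotv_conj dotvDl rmorphD/= -!dotv_conj. Qed.

Lemma dotv0r z : dotv z (0 : V) = 0.
Proof. by rewrite dotv_conj dotv0l rmorph0. Qed.

Lemma dotvZr a x z : dotv z (a *: x) = conjs a * dotv z x.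
Proof. by rewrite dotv_conj dotvZl rmorphM/= -dotv_conj. Qed.

Lemma dotvNr x z : dotv z (- x) = - dotv z x.
Proof. by rewrite -scaleN1r dotvZr rmorphN1/= mulN1r. Qed.

Lemma dotvBr x y z : dotv z (x - y) = dotv z x - dotv z y.
Proof. by rewrite dotvDr dotvNr. Qed.

Lemma res_conjs a : res (conjs a) = res a.
Proof. by move: a; case: k => // -[]. Qed.

Lemma res_reals_mul (r : R) a : res (reals r * a) = r * res a.
Proof. by move: a; case: k => // -[p q] /=; rewrite mul0r subr0. Qed.

Lemma conjs_reals (r : R) : conjs (reals r : K) = reals r.
Proof. by case: k => //; apply/eqP; rewrite eq_complex /= oppr0 !eqxx. Qed.

Lemma rnorm_reals (r : R) : rnorm (reals r : K) = `|r|.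
Proof. by rewrite /rnorm normr_reals realsK. Qed.

Lemma res_mulcc a : res (conjs a * a) = rnorm a ^+ 2.
Proof. by rewrite mulrC mul_conjs -reals_rnorm -rmorphXn/= realsK. Qed.

Lemma res_le_rnorm a : res a <= rnorm a.
Proof.
rewrite -(ler_reals k) reals_rnorm; move: a.
case: k => a; first exact: ler_norm.
by apply: le_trans (normc_ge_Re a); rewrite lecR ler_norm.
Qed.

Lemma dotvv_rnorm x : dotv x x = reals (rnorm x ^+ 2).
Proof. by rewrite dotvv rmorphXn/= reals_rnorm. Qed.

Lemma res_dotvv x : res (dotv x x) = rnorm x ^+ 2.
Proof. by rewrite dotvv_rnorm realsK. Qed.

Lemma rnorm_dotvC x y : rnorm (dotv x y) = rnorm (dotv y x).
Proof. by rewrite dotv_conj rnorm_conjs. Qed.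

Lemma dotvv_eq0 x : dotv x x = 0 -> x = 0.
Proof.
move=> x0; apply: (@rnorm0_eq0 R k); apply/eqP; rewrite -sqrf_eq0.
by rewrite -res_dotvv x0 raddf0.
Qed.

Lemma rnorm_gt0 x : x != 0 -> 0 < rnorm x.
Proof.
move=> x0; rewrite lt_def rnorm_ge0 andbT.
by apply: contra_neq x0; exact: rnorm0_eq0.
Qed.

Lemma rnorm_sqD x y :
  rnorm (x + y) ^+ 2 = rnorm x ^+ 2 + rnorm y ^+ 2 + 2 * res (dotv x y).
Proof.
rewrite -!res_dotvv dotvDl !dotvDr !raddfD/= [dotv y x]dotv_conj res_conjs.
ring.
Qed.

Lemma rnorm_sqB x y :
  rnorm (x - y) ^+ 2 = rnorm x ^+ 2 + rnorm y ^+ 2 - 2 * res (dotv x y).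
Proof. by rewrite rnorm_sqD rnormN dotvNr raddfN/= mulrN. Qed.

(** The common optimisation behind the Cauchy-Schwarz inequality and the Riesz
    theorem: minimise the quadratic in [u], at [u = 1 / t] if [t > 0]. The
    factor [s] appears in both coefficients because it comes from the phase
    trick of [rnorm_sqDphase]. *)
Lemma quadratic_ge0 (r s t : R) : 0 <= s -> 0 <= t ->
  (forall u, 0 <= r - 2 * u * s + u ^+ 2 * s * t) -> s <= r * t.
Proof.
move=> s0 t0 h; have [t00|tn0] := eqVneq t 0.
  have [->|sn0] := eqVneq s 0; first by have := h 0; rewrite t00 !mulr0.
  have := h ((r + 1) / (2 * s)).
  rewrite t00 !mulr0 addr0.
  have -> : r - 2 * ((r + 1) / (2 * s)) * s = - 1 by field.
  by rewrite lerNr oppr0 lt_geF.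
have tp : 0 < t by rewrite lt_def tn0.
have := h t^-1.
have -> : r - 2 * t^-1 * s + t^-1 ^+ 2 * s * t = r - s / t by field.
by rewrite subr_ge0 ler_pdivrMr.
Qed.

(** Moving along [y] with a coefficient of phase [conjs a] makes the cross term
    real when [a] is the conjugate of [dotv x y], so that real quadratics
    decide questions about scalars of either kind. *)
Lemma rnorm_sqDphase x y (r : R) a :
  rnorm (x - (reals r * conjs a) *: y) ^+ 2 =
  rnorm x ^+ 2 + r ^+ 2 * rnorm a ^+ 2 * rnorm y ^+ 2
  - 2 * r * res (a * dotv x y).
Proof.
rewrite rnorm_sqB rnormZ dotvZr rmorphM/= conjs_reals conjsK -mulrA.
rewrite res_reals_mul.
by rewrite rnormM rnorm_reals rnorm_conjs !exprMn real_normK ?num_real//; ring.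
Qed.

Lemma cauchy_schwarz x y : rnorm (dotv x y) <= rnorm x * rnorm y.
Proof.
rewrite -(@ler_pXn2r _ 2)// ?nnegrE ?mulr_ge0 ?rnorm_ge0// exprMn.
apply: quadratic_ge0 => [||u]; rewrite ?sqr_ge0//.
have := sqr_ge0 (rnorm (x - (reals u * conjs (conjs (dotv x y))) *: y)).
rewrite rnorm_sqDphase res_mulcc rnorm_conjs.
by move: (rnorm (dotv x y)) => g; lra.
Qed.

Lemma rnorm_le_dotvv x (C : R) : 0 <= C ->
  rnorm (dotv x x) <= C * rnorm x -> rnorm x <= C.
Proof.
move=> C0; have [->|x0] := eqVneq x 0; first by rewrite rnorm0.
rewrite dotvv_rnorm rnorm_reals ger0_norm ?sqr_ge0// expr2.
by rewrite ler_pM2r// rnorm_gt0.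
Qed.

End Basics.

(** * Closures and limits through real-valued norms *)

Section Metric.
Variables (R : realType) (k : scalar_kind).
Local Notation K := (scalar R k).

Lemma closure_rnorm (V : normedModType K) (D : set V) (x : V) :
  closure D x <-> forall e : R, 0 < e -> exists2 d, D d & rnorm (x - d) < e.
Proof.
split=> [cDx e e0|h B].
  have re0 : (0 : K) < reals e by rewrite -[0](rmorph0 reals) ltr_reals.
  have /cDx [d [Dd]] := nbhsx_ballx x _ re0.
  by rewrite -ball_normE/= -reals_rnorm ltr_reals => xd; exists d.
move=> /nbhs_ballP[e /= e0 eB].
have re0 : 0 < res e by rewrite -(ltr_reals k) rmorph0 resK// ltW.
have [d Dd xd] := h _ re0; exists d; split => //; apply: eB.
by rewrite -ball_normE/= -reals_rnorm -[e]resK ?ltr_reals// ltW.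
Qed.

(** Completeness with an explicit rate: all limits below come with a bound on
    the distance to the approximants, so the rate is kept in the conclusion. *)
Lemma complete_rate (V : completeNormedModType K) (u : nat -> V)
    (r : nat -> R) :
  (forall n p, (n <= p)%N -> rnorm (u p - u n) <= r n) ->
  (forall e, 0 < e -> exists n, r n < e) ->
  exists l, forall n, rnorm (l - u n) <= r n.
Proof.
move=> hu hr.
have /cvg_ex[l ul] : cvgn u.
  apply: cauchy_cvg; apply/cauchy_ballP => e e0.
  have re0 : 0 < res e by rewrite -(ltr_reals k) rmorph0 resK// ltW.
  have [n rn] := hr _ (divr_gt0 re0 (ltr0n R 2)).
  rewrite near_map2; exists ([set m | (n <= m)%N], [set m | (n <= m)%N]).
    by split; exists n.
  move=> [p q] /= [np nq]; rewrite -ball_normE/= -reals_rnorm.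
  rewrite -[e]resK ?ltW// ltr_reals.
  rewrite -(subrKA (u n)); apply: le_lt_trans (rnorm_leD _ _) _.
  rewrite -[rnorm (u n - _)]rnormN opprB (splitr (res e)).
  by apply: ltrD; apply: le_lt_trans rn; exact: hu.
exists l => n; apply/ler_addgt0Pl => e e0.
have re0 : (0 : K) < reals e by rewrite -[0](rmorph0 reals) ltr_reals.
move/cvgrPdist_lt : ul => /(_ _ re0) [N _ hN].
have := hN (maxn n N) (leq_maxr _ _); rewrite /= -reals_rnorm ltr_reals => lu.
rewrite -(subrKA (u (maxn n N))); apply: le_trans (rnorm_leD _ _) _.
by apply: lerD; [exact: ltW | exact/hu/leq_maxl].
Qed.

(** Extension by density, in the only form in which closures are passed to
    below. *)
Lemma closure_bound (V W : normedModType K) (D : set V) (phi : V -> W)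
    (L C : R) : 0 <= C ->
  {morph phi : x y / x - y} -> (forall x, rnorm (phi x) <= L * rnorm x) ->
  (forall x, D x -> rnorm (phi x) <= C * rnorm x) ->
  forall x, closure D x -> rnorm (phi x) <= C * rnorm x.
Proof.
move=> C0 phiB phiL phiC x /closure_rnorm Dx; apply/ler_addgt0Pl => e e0.
pose M := C + `|L| + 1.
have M0 : 0 < M by rewrite ltr_wpDl// addr_ge0.
have [d Dd xd] := Dx (e / M) (divr_gt0 e0 M0).
rewrite -[phi x](subrK (phi d)) -phiB.
apply: le_trans (rnorm_leD _ _) _.
have h1 := phiL (x - d); have h2 := phiC d Dd.
have h3 : rnorm d <= rnorm (x - d) + rnorm x.
  rewrite -[rnorm (x - d)]rnormN opprB.
  by rewrite -[in leLHS](subrK x d) rnorm_leD.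
have h4 : L * rnorm (x - d) <= `|L| * rnorm (x - d).
  by rewrite ler_wpM2r ?rnorm_ge0 ?ler_norm.
have h5 := ler_wpM2l C0 h3.
have h6 : M * rnorm (x - d) <= e by rewrite mulrC -ler_pdivlMr ?ltW.
have h7 := rnorm_ge0 (x - d).
rewrite /M in h6; nra.
Qed.

Lemma closure_vanish (V W : normedModType K) (D : set V) (phi : V -> W)
    (L : R) :
  {morph phi : x y / x - y} -> (forall x, rnorm (phi x) <= L * rnorm x) ->
  (forall x, D x -> phi x = 0) -> forall x, closure D x -> phi x = 0.
Proof.
move=> phiB phiL phi0 x Dx; apply: (@rnorm0_eq0 R k); apply/eqP.
rewrite eq_le rnorm_ge0 andbT.
have := @closure_bound _ _ D phi L 0 (lexx 0) phiB phiL _ x Dx; rewrite mul0r.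
by apply=> y Dy; rewrite mul0r phi0// rnorm0.
Qed.

End Metric.

(** * The Riesz theorem for linear relations *)

Section Relations.
Variables (R : realType) (k : scalar_kind).
Local Notation K := (scalar R k).

(** A linear map that is not defined everywhere, or only determined through the
    values of another map, is given by its graph, a linear subspace of the
    product; no choice of a section or of values outside the domain is made. *)
Definition linear_relation (V W : lmodType K) (G : V -> W -> Prop) : Prop :=
  G 0 0 /\
  forall a v w v' w', G v w -> G v' w' -> G (a *: v + v') (a *: w + w').

Definition rel_dom (V W : lmodType K) (G : V -> W -> Prop) : set V :=
  [set v | exists w, G v w].

Definition rel_ran (V W : lmodType K) (G : V -> W -> Prop) : set W :=
  [set w | exists v, G v w].

Lemma linear_relationZ (V W : lmodType K) (G : V -> W -> Prop) a v w :
  linear_relation G -> G v w -> G (a *: v) (a *: w).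
Proof. by move=> [G0 GD] Gvw; have := GD a _ _ _ _ Gvw G0; rewrite !addr0. Qed.

Lemma invr_nat_lt (e : R) : 0 < e -> exists n, n.+1%:R^-1 < e.
Proof.
move=> e0; exists (Num.trunc e^-1).
by rewrite invf_plt ?posrE//; exact: truncnS_gt.
Qed.

(** The representing vector is the limit of a minimising sequence of
    [|v|^2 - 2 Re g] over the pairs [G v g]. The parallelogram identity makes
    this sequence Cauchy, and almost minimality along the direction of any pair
    [(z, h)] forces [h] to be close to [dotv z v]. Functionals on arbitrary
    subspaces are covered, so that orthogonal projections, adjoints and
    factorisations through a bounded operator are special cases. *)
Lemma riesz_relation (V : hilbertType R k) (G : V -> K^o -> Prop) (L : R) :
  linear_relation G -> (forall v g, G v g -> rnorm (g : K) <= L * rnorm v) ->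
  exists2 w, closure (rel_dom G) w & forall v g, G v g -> g = dotv v w.
Proof.
move=> Glin GL; have [G0 GD] := Glin.
pose q (v : V) (g : K) : R := rnorm v ^+ 2 - 2 * res g.
pose Q := [set r | exists v g, G v g /\ r = q v g].
have Qlb : lbound Q (- L ^+ 2).
  move=> _ [v [g [Gvg ->]]]; have := GL _ _ Gvg.
  have := res_le_rnorm (g : K); have := sqr_ge0 (rnorm v - L).
  rewrite /q; lra.
have Qinf : has_inf Q by split; [exists (q 0 0), 0, 0 | exists (- L ^+ 2)].
have Qge v g : G v g -> inf Q <= q v g.
  by move=> Gvg; apply: ge_inf; [exact: Qinf.2 | exists v, g].
pose d n : R := n.+1%:R^-1.
have d0 n : 0 < d n by rewrite invr_gt0.
have /choice[vg vgP] : forall n, exists p : V * K,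
    G p.1 p.2 /\ q p.1 p.2 < inf Q + d n ^+ 2.
  move=> n; have [_ [v [g [Gvg ->]]] lt] :=
    inf_adherent (exprn_gt0 2 (d0 n)) Qinf.
  by exists (v, g).
have dle n p : (n <= p)%N -> d p <= d n.
  by move=> np; rewrite lef_pV2 ?posrE// ler_nat.
have darch e : 0 < e -> exists n, 2 * d n < e.
  move=> e0; have [n ne] := invr_nat_lt (divr_gt0 e0 (ltr0n R 2)).
  by exists n; rewrite mulrC -ltr_pdivlMr.
(* Any two almost minimal vectors are close, as their midpoint stays in the
   domain and its value is at least the infimum. *)
have [w hw] : exists w, forall n, rnorm (w - (vg n).1) <= 2 * d n.
  apply: complete_rate => // n p np.
  rewrite -(@ler_pXn2r _ 2)// ?nnegrE ?rnorm_ge0 ?mulr_ge0 ?(ltW (d0 n))//.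
  have [Gn qn] := vgP n; have [Gp qp] := vgP p.
  have := GD (reals 2^-1) _ _ _ _ Gn (linear_relationZ (reals 2^-1) Glin Gp).
  move=> /Qge; rewrite -!scalerDr /q rnormZ rnorm_reals.
  rewrite [res _](_ : _ = 2^-1 * (res (vg n).2 + res (vg p).2)); last first.
    by rewrite [_ *: _]/(_ * _) res_reals_mul raddfD.
  rewrite exprMn rnorm_sqD real_normK ?num_real// rnorm_sqB dotv_conj res_conjs.
  have := dle _ _ np; have := d0 n; have := d0 p.
  by move: qn qp; rewrite /q; nra.
exists w.
  apply/closure_rnorm => e /darch[n ne]; exists (vg n).1.
    by exists (vg n).2; exact: (vgP n).1.
  exact: le_lt_trans (hw n) ne.
move=> z h Gzh; apply/eqP; rewrite -subr_eq0; apply/eqP/(@rnorm0_eq0 R k).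
(* The value at [vg n + u * conjs e * (z, h)] is at least the infimum for every
   real [u]. *)
have key n : rnorm ((h : K) - dotv z (vg n).1) <= d n * rnorm z.
  set e := _ - _; have [Gn qn] := vgP n.
  have dn0 := ltW (d0 n).
  rewrite -(@ler_pXn2r _ 2)// ?nnegrE ?mulr_ge0 ?rnorm_ge0// exprMn.
  apply: quadratic_ge0 => [||u]; rewrite ?sqr_ge0//.
  have := GD (- (reals (- u) * conjs e)) _ _ _ _ Gzh Gn.
  move=> /Qge; rewrite /q [- _ *: z + _]addrC !scaleNr rnorm_sqDphase.
  rewrite [res (- _ + _)](_ : _ =
    u * res (conjs e * h) + res (vg n).2); last first.
    rewrite raddfD raddfN/= -[_ *: h]/((reals (- u) * conjs e) * (h : K)).
    by rewrite -mulrA res_reals_mul mulNr opprK.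
  have -> : res (e * dotv (vg n).1 z) = res (conjs e * dotv z (vg n).1).
    by rewrite [dotv z _]dotv_conj -rmorphM/= res_conjs.
  have -> : rnorm e ^+ 2 = res (conjs e * h) - res (conjs e * dotv z (vg n).1).
    by rewrite -res_mulcc /e mulrBr raddfB.
  by move: qn; rewrite /q; lra.
apply/eqP; rewrite eq_le rnorm_ge0 andbT.
apply/ler_addgt0Pl => e e0; rewrite addr0.
have z0 := rnorm_ge0 z.
have e'0 : 0 < e / (2 * (rnorm z + 1)).
  by rewrite divr_gt0// mulr_gt0// ltr_wpDl.
have [n ne] := darch _ e'0.
have -> : (h : K) - dotv z w = (h - dotv z (vg n).1) - dotv z (w - (vg n).1).
  by rewrite dotvBr opprB subrKA.
apply: le_trans (rnorm_leD _ _) _; rewrite rnormN.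
have h1 := key n; have h2 := cauchy_schwarz z (w - (vg n).1); have h3 := hw n.
move: ne; rewrite ltr_pdivlMr ?mulr_gt0// ?ltr_wpDl//.
have h4 := d0 n; have := ler_wpM2l z0 h3; nra.
Qed.

End Relations.

(** * Orthogonal projections and extension of bounded relations *)

Section Orthogonality.
Variables (R : realType) (k : scalar_kind).
Local Notation K := (scalar R k).

Lemma subspace_closure (V : normedModType K) (D : set V) :
  linear_subspace D -> linear_subspace (closure D).
Proof.
move=> [D0 DD]; split; first exact: subset_closure.
move=> a x y /closure_rnorm Dx /closure_rnorm Dy; apply/closure_rnorm => e e0.
have e20 : 0 < e / 2 by rewrite divr_gt0.
have a10 : 0 < rnorm a + 1 by rewrite ltr_wpDl ?rnorm_ge0.
have [d Dd dx] := Dx _ (divr_gt0 e20 a10); have [c Dc cy] := Dy _ e20.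
exists (a *: d + c); first exact: DD.
rewrite opprD addrACA -scalerBr; apply: le_lt_trans (rnorm_leD _ _) _.
rewrite (splitr e) rnormZ; apply: ler_ltD cy.
move: dx; rewrite ltr_pdivlMr// mulrC => /ltW; apply: le_trans.
by rewrite ler_wpM2r ?rnorm_ge0// lerDl.
Qed.

Lemma dotv_closure_le (V : preHilbertType R k) (D : set V) (x z : V) (C : R) :
  0 <= C -> (forall d, D d -> rnorm (dotv d z) <= C * rnorm d) ->
  closure D x -> rnorm (dotv x z) <= C * rnorm x.
Proof.
move=> C0 Dz Dx.
apply: (@closure_bound R k V K^o D (fun d => dotv d z) (rnorm z) C) Dx => //.
- by move=> c d; exact: dotvBl.
- by move=> d; rewrite mulrC; exact: cauchy_schwarz.
Qed.

Lemma dotv_closure0 (V : preHilbertType R k) (D : set V) (x z : V) :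
  closure D x -> (forall d, D d -> dotv d z = 0) -> dotv x z = 0.
Proof.
move=> Dx Dz.
apply: (@rnorm0_eq0 R k); apply/eqP; rewrite eq_le rnorm_ge0 andbT.
rewrite -[leRHS](mul0r (rnorm x)).
by apply: dotv_closure_le Dx => // d /Dz ->; rewrite rnorm0 mul0r.
Qed.

Lemma dotv_closure_eq0 (V : preHilbertType R k) (D : set V) (x : V) :
  closure D x -> (forall d, D d -> dotv d x = 0) -> x = 0.
Proof. by move=> Dx /(dotv_closure0 Dx)/(@dotvv_eq0 R k). Qed.

Lemma orthogonal_projection (V : hilbertType R k) (D : set V) (x : V) :
  linear_subspace D ->
  exists2 w, closure D w & forall d, D d -> dotv d (x - w) = 0.
Proof.
move=> [D0 DD].
have [|d g [_ ->]|w w1 w2] := @riesz_relation R k V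
  (fun d g => D d /\ g = dotv d x) (rnorm x).
- split=> [|a v g v' g' [Dv ->] [Dv' ->]]; first by rewrite dotv0l.
  by rewrite dotvDl dotvZl; split => //; exact: DD.
- by rewrite mulrC; exact: cauchy_schwarz.
exists w; last by move=> d Dd; rewrite dotvBr -(w2 d (dotv d x)) ?subrr.
by apply: closureS w1 => d [g []].
Qed.

(** The double orthogonal complement of [D] is contained in its closure, since
    the residual of the projection of [x] is orthogonal to [D]. *)
Lemma closure_orth (V : hilbertType R k) (D : set V) (x : V) :
  linear_subspace D ->
  (forall z, (forall d, D d -> dotv d z = 0) -> dotv x z = 0) -> closure D x.
Proof.
move=> Dlin xD; have [w Dw wD] := orthogonal_projection x Dlin.
suff -> : x = w by [].
apply/eqP; rewrite -subr_eq0; apply/eqP/(@dotvv_eq0 R k).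
by rewrite {1}dotvBl (dotv_closure0 Dw wD) subr0; exact: xD.
Qed.

End Orthogonality.

Section Extension.
Variables (R : realType) (k : scalar_kind).
Local Notation K := (scalar R k).

Definition linear_of (U V : lmodType K) (t : U -> V) of linear t := t.

Section LinearOf.
Variables (U V : lmodType K) (t : U -> V) (tl : linear t).
HB.instance Definition _ := GRing.isLinear.Build K U V *:%R (linear_of tl) tl.
End LinearOf.

Lemma dotv_ext (V : preHilbertType R k) (x y : V) :
  (forall z, dotv z x = dotv z y) -> x = y.
Proof.
move=> xy; apply/eqP; rewrite -subr_eq0; apply/eqP/(@dotvv_eq0 R k).
by rewrite dotvBr xy subrr.
Qed.

Lemma rel_dom_subspace (V W : normedModType K) (G : V -> W -> Prop) :
  linear_relation G -> linear_subspace (rel_dom G).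
Proof.
move=> [G0 GD]; split; first by exists 0.
by move=> a x y [v xv] [w yw]; exists (a *: v + w); exact: GD.
Qed.

Lemma rel_ran_subspace (V W : normedModType K) (G : V -> W -> Prop) :
  linear_relation G -> linear_subspace (rel_ran G).
Proof.
move=> [G0 GD]; split; first by exists 0.
by move=> a x y [v xv] [w yw]; exists (a *: v + w); exact: GD.
Qed.

Lemma bounded_adjoint (V W : preHilbertType R k) (T : V -> W) (T' : W -> V)
    (L : R) : 0 <= L ->
  (forall x y, dotv (T x) y = dotv x (T' y)) ->
  (forall x, rnorm (T x) <= L * rnorm x) ->
  forall y, rnorm (T' y) <= L * rnorm y.
Proof.
move=> L0 TT' TL y; apply: (@rnorm_le_dotvv R k).
  by rewrite mulr_ge0 ?rnorm_ge0.
rewrite -TT'; apply: le_trans (cauchy_schwarz _ _) _.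
by rewrite [leRHS]mulrAC ler_wpM2r ?rnorm_ge0.
Qed.

(** A bounded linear relation extends to a bounded operator: the adjoint comes
    first, since [T' y] is the Riesz representation, in the closure of the
    domain, of [v |-> dotv w y] for [G v w]. This does in one stroke what
    extension by continuity to the closed domain, followed by a projection onto
    it, would do. *)
Lemma bounded_extension (V W : hilbertType R k) (G : V -> W -> Prop) (L : R) :
  0 <= L -> linear_relation G ->
  (forall v w, G v w -> rnorm w <= L * rnorm v) ->
  exists (T : {linear V -> W}) (T' : {linear W -> V}),
    [/\ forall x y, dotv (T x) y = dotv x (T' y),
        forall x, rnorm (T x) <= L * rnorm x,
        forall v w, G v w -> T v = w,
        forall x, closure (rel_ran G) (T x)
      & forall y, closure (rel_dom G) (T' y)].
Proof.
move=> L0 Glin GL; have [G0 GD] := Glin.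
have domlin := rel_dom_subspace Glin; have ranlin := rel_ran_subspace Glin.
have /choice[t' t'P] : forall y, exists u, closure (rel_dom G) u /\
    forall v w, G v w -> dotv w y = dotv v u.
  move=> y; have [|v g [w [Gvw ->]]|u u1 u2] := @riesz_relation R k V
    (fun v g => exists w, G v w /\ g = dotv w y) (L * rnorm y).
  - split=> [|a v g v' g' [w [Gvw ->]] [w' [Gvw' ->]]].
      by exists 0; rewrite dotv0l.
    exists (a *: w + w'); split; first exact: GD.
    by rewrite dotvDl dotvZl.
  - apply: le_trans (cauchy_schwarz _ _) _.
    by rewrite mulrAC ler_wpM2r ?rnorm_ge0// GL.
  exists u; split; last by move=> v w Gvw; apply: u2; exists w.
  by apply: closureS u1 => v [g [w [Gvw _]]]; exists w.
have t'lin : linear t'.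
  move=> a y z; apply/eqP; rewrite -subr_eq0; apply/eqP.
  have [c0 cD] := subspace_closure domlin.
  apply: (@dotv_closure_eq0 R k V (rel_dom G)).
    rewrite [t' _ - _]addrC -scaleN1r; apply: (cD); last exact: (t'P _).1.
    by apply: (cD); exact: (t'P _).1.
  move=> v [w Gvw]; rewrite dotvBr [dotv v (_ + _)]dotvDr dotvZr.
  by rewrite -!(proj2 (t'P _) _ _ Gvw) dotvDr dotvZr subrr.
have t'L y : rnorm (t' y) <= L * rnorm y.
  have C0 : 0 <= L * rnorm y by rewrite mulr_ge0 ?rnorm_ge0.
  apply: (@rnorm_le_dotvv R k) => //; apply: dotv_closure_le (t'P y).1 => //.
  move=> v [w Gvw]; rewrite -((t'P y).2 v w Gvw).
  apply: le_trans (cauchy_schwarz _ _) _.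
  by rewrite mulrAC ler_wpM2r ?rnorm_ge0// GL.
have /choice[t tP] : forall x, exists u, forall y, dotv (t' y) x = dotv y u.
  move=> x; have [|y g ->|u _ u2] := @riesz_relation R k W
    (fun y g => g = dotv (t' y) x) (L * rnorm x).
  - split=> [|a v g v' g' -> ->].
      have := t'lin (-1) 0 0; rewrite scaler0 addr0 scaleN1r addNr => ->.
      by rewrite dotv0l.
    by rewrite t'lin dotvDl dotvZl.
  - apply: le_trans (cauchy_schwarz _ _) _.
    by rewrite mulrAC ler_wpM2r ?rnorm_ge0// t'L.
  by exists u => y; exact: u2.
have tt' x y : dotv (t x) y = dotv x (t' y) by rewrite dotv_conj -tP -dotv_conj.
have tlin : linear t.
  move=> a x y; apply: dotv_ext => z.
  by rewrite -tP !dotvDr !dotvZr -!tP.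
exists (linear_of tlin), (linear_of t'lin); split => //.
- apply: (bounded_adjoint L0) t'L => x y.
  by rewrite dotv_conj /linear_of -tt' -dotv_conj.
- move=> v w Gvw; apply: dotv_ext => z; rewrite /= /linear_of -tP.
  by rewrite dotv_conj -(proj2 (t'P _) _ _ Gvw) -dotv_conj.
- move=> x; apply: closure_orth => // z ranz; rewrite /= /linear_of tt'.
  rewrite (@dotv_closure_eq0 R k V _ _ (t'P z).1) ?dotv0r// => v [w Gvw].
  by rewrite -(proj2 (t'P _) _ _ Gvw); apply: ranz; exists v.
- by move=> y; exact: (t'P y).1.
Qed.

Lemma adjoint_exists (V W : hilbertType R k) (B : {linear V -> W}) (L : R) :
  0 <= L -> (forall x, rnorm (B x) <= L * rnorm x) ->
  exists B' : {linear W -> V}, forall x y, dotv (B x) y = dotv x (B' y).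
Proof.
move=> L0 BL.
have [|v w ->|T [B' [TB' _ TB _ _]]] :=
  @bounded_extension V W (fun x y => y = B x) L L0 => //.
  split=> [|a x _ y _ -> ->]; first by rewrite linear0.
  by rewrite linearP.
by exists B' => x y; rewrite -TB' (TB _ _ erefl).
Qed.

Lemma isometric_extension (V W : hilbertType R k) (G : V -> W -> Prop) :
  linear_relation G ->
  (forall v w v' w', G v w -> G v' w' -> dotv w w' = dotv v v') ->
  exists (T : {linear V -> W}) (T' : {linear W -> V}),
    [/\ forall x y, dotv (T x) y = dotv x (T' y),
        forall x, rnorm (T x) <= rnorm x,
        forall v w, G v w -> T v = w,
        forall x, closure (rel_ran G) (T x)
      & forall x y, closure (rel_dom G) x -> closure (rel_dom G) y ->
          dotv (T x) (T y) = dotv x y].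
Proof.
move=> Glin GG.
have [v w Gvw|T [T' [TT' TL TG Tran T'dom]]] :=
  @bounded_extension V W G 1 ler01 Glin.
  rewrite mul1r -(@ler_pXn2r _ 2)// ?nnegrE ?rnorm_ge0//.
  by rewrite -!res_dotvv (GG v w v w).
exists T, T'; split => // [x|x y domx domy].
  by have := TL x; rewrite mul1r.
apply/eqP; rewrite -subr_eq0 TT' -dotvBr; apply/eqP.
apply: dotv_closure0 domx _ => v [w Gvw].
rewrite dotv_conj (_ : dotv _ v = 0) ?rmorph0//.
rewrite dotvBl; apply/eqP; rewrite subr_eq0; apply/eqP.
rewrite dotv_conj -TT' -dotv_conj.
apply/eqP; rewrite -subr_eq0 TT' -dotvBr; apply/eqP.
apply: dotv_closure0 domy _ => v' [w' Gvw'].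
by rewrite dotvBr -TT' !(TG _ _ Gvw) !(TG _ _ Gvw') (GG _ _ _ _ Gvw' Gvw) subrr.
Qed.

End Extension.

(** * Positive square roots *)

Section SquareRoot.
Variables (R : realType) (k : scalar_kind).
Local Notation K := (scalar R k).

Lemma conjs_real (a : K) : conjs a = a -> reals (res a) = a.
Proof.
move: a; case: k => // -[p q] /= /eqP.
rewrite eq_complex /= => /andP[_ /eqP qq].
by apply/eqP; rewrite eq_complex /= eqxx /=; apply/eqP; lra.
Qed.

Lemma reals_half_double (V : lmodType K) (x : V) :
  (reals 2^-1 : K) *: (x + x) = x.
Proof.
have -> : x + x = (2%:R : K) *: x by rewrite scaler_nat mulr2n.
rewrite scalerA -[X in _ * X](rmorph_nat (@reals R k)) -rmorphM/=.
by rewrite mulVf ?pnatr_eq0// rmorph1 scale1r.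
Qed.

(** If [0 <= Q <= 1] then [Y = 1 - (1 - Q)^(1/2)] is a fixed point of
    [Y |-> (Q + Y^2) / 2]; the square root of [1 - Q] is obtained by iterating
    this map from 0. *)
Fixpoint sqrt_iter (V : lmodType K) (Q : V -> V) n (x : V) : V :=
  if n is m.+1 then
    (reals 2^-1 : K) *: (Q x + sqrt_iter Q m (sqrt_iter Q m x))
  else 0.

(** The scalar iteration with [Q = 1], which increases to 1. It dominates the
    operator iteration: norms of iterates and of their increments for a
    contraction [Q] are at most the corresponding scalars. *)
Fixpoint sqrt_iter1 n : R :=
  if n is m.+1 then (1 + sqrt_iter1 m ^+ 2) / 2 else 0.

Local Notation y := sqrt_iter1.

Lemma sqrt_iter1_itv n : 0 <= y n <= 1.
Proof.
elim: n => [|n /andP[y0 y1]] /=; first by rewrite lexx ler01.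
by apply/andP; split; nra.
Qed.

Lemma sqrt_iter1_le n : y n <= y n.+1.
Proof. by rewrite /=; have := sqr_ge0 (y n - 1); lra. Qed.

(** The recursion maps [e = 1 - sqrt_iter1 n] to [e - e^2 / 2], a discrete
    version of the differential equation [de/dt = - e^2 / 2], whose solutions
    decay like [2 / t]. *)
Lemma sqrt_iter1_rate n : 1 - y n <= 2 / n.+2%:R.
Proof.
elim: n => [|n]; first by rewrite subr0 divff.
rewrite !ler_pdivlMr// => h; have /andP[y0 y1] := sqrt_iter1_itv n.
rewrite -[n.+3]addn1 natrD /=.
have h' : 0 <= (2 - (1 - y n) * n.+2%:R) * y n by rewrite mulr_ge0 ?subr_ge0.
have := sqr_ge0 (1 - y n); nra.
Qed.

Lemma sqrt_iter1_small e : 0 < e -> exists n, 1 - y n < e.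
Proof.
move=> e0; have [n ne] := invr_nat_lt (divr_gt0 e0 (ltr0n R 2)).
exists n; apply: le_lt_trans (sqrt_iter1_rate n) _.
rewrite mulrC -ltr_pdivlMr//; apply: le_lt_trans ne.
by rewrite lef_pV2 ?posrE// ler_nat.
Qed.

Section Contraction.
Variables (V : hilbertType R k) (Q : {linear V -> V}).
Hypothesis Qsa : forall x z, dotv (Q x) z = dotv x (Q z).
Hypothesis Q1 : forall x, rnorm (Q x) <= rnorm x.
Local Notation Y := (sqrt_iter Q).

Lemma sqrt_iter_linear n : linear (Y n).
Proof.
elim: n => [|n IHn] a x z /=; first by rewrite scaler0 addr0.
rewrite !IHn linearP scalerA mulrC -scalerA -scalerDr; congr (_ *: _).
by rewrite scalerDr addrACA.
Qed.

Lemma sqrt_iterB n : {morph Y n : x z / x - z}.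
Proof.
move=> x z; rewrite addrC -scaleN1r sqrt_iter_linear scaleN1r addrC//.
Qed.

Lemma sqrt_iterQ n x : Y n (Q x) = Q (Y n x).
Proof.
elim: n x => [|n IHn] x /=; first by rewrite linear0.
by rewrite !IHn linearZ/=; congr (_ *: _); rewrite [RHS]linearD.
Qed.

Lemma sqrt_iterC n x : Y n.+1 (Y n x) = Y n (Y n.+1 x).
Proof.
rewrite /= -sqrt_iterQ.
have := sqrt_iter_linear n (reals 2^-1) (Q x + Y n (Y n x)) 0.
have YD z t : Y n (z + t) = Y n z + Y n t.
  by have := sqrt_iter_linear n 1 z t; rewrite !scale1r.
have Y0 : Y n 0 = 0 by apply: (addrI (Y n 0)); rewrite -YD !addr0.
by rewrite addr0 Y0 addr0 YD => ->.
Qed.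

Lemma sqrt_iter_sa n x z : dotv (Y n x) z = dotv x (Y n z).
Proof.
elim: n x z => [|n IHn] x z /=; first by rewrite dotv0l dotv0r.
by rewrite dotvZl dotvZr conjs_reals dotvDl dotvDr !IHn Qsa.
Qed.

Lemma rnorm_half (x : V) : rnorm ((reals 2^-1 : K) *: x) = rnorm x / 2.
Proof. by rewrite rnormZ rnorm_reals ger0_norm// mulrC. Qed.

Lemma sqrt_iter_le n x : rnorm (Y n x) <= y n * rnorm x.
Proof.
elim: n x => [|n IHn] x /=; first by rewrite rnorm0 mul0r.
have /andP[y0 _] := sqrt_iter1_itv n.
rewrite rnorm_half mulrAC ler_pM2r ?invr_gt0//.
apply: le_trans (rnorm_leD _ _) _; rewrite mulrDl mul1r lerD ?Q1//.
by apply: le_trans (IHn _) _; rewrite expr2 -mulrA ler_wpM2l.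
Qed.

Lemma sqrt_iter_le1 n x : rnorm (Y n x) <= rnorm x.
Proof.
apply: le_trans (sqrt_iter_le n x) _; rewrite ler_piMl ?rnorm_ge0//.
by have /andP[] := sqrt_iter1_itv n.
Qed.

(** Consecutive iterates commute, so the increment of the square factors as
    [(Y n.+1 + Y n) (Y n.+1 - Y n)], exactly as for scalars. *)
Lemma sqrt_iter_step n x :
  rnorm (Y n.+1 x - Y n x) <= (y n.+1 - y n) * rnorm x.
Proof.
elim: n x => [|n IHn] x.
  rewrite /= !subr0 expr0n/= !addr0 rnorm_half div1r mulrC.
  by rewrite ler_pM2l ?invr_gt0.
have -> : Y n.+2 x - Y n.+1 x =
    (reals 2^-1 : K) *: (Y n.+1 (Y n.+1 x - Y n x) + Y n (Y n.+1 x - Y n x)).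
  rewrite !sqrt_iterB sqrt_iterC subrKA.
  rewrite [Y n.+2]/= [in X in _ - X = _]/= -scalerBr; congr (_ *: _).
  by rewrite opprD addrACA subrr add0r.
rewrite rnorm_half.
have -> : y n.+2 - y n.+1 = (y n.+1 + y n) * (y n.+1 - y n) / 2.
  by rewrite /=; field.
set d := _ - _.
have hd := IHn x; rewrite -/d in hd.
have h1 := sqrt_iter_le n.+1 d; have h2 := sqrt_iter_le n d.
have h3 := rnorm_leD (Y n.+1 d) (Y n d).
have /andP[a0 a1] := sqrt_iter1_itv n; have /andP[b0 b1] := sqrt_iter1_itv n.+1.
have h4 : (y n.+1 + y n) * rnorm d <=
    (y n.+1 + y n) * ((y n.+1 - y n) * rnorm x).
  by rewrite ler_wpM2l ?addr_ge0.
lra.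
Qed.

Lemma sqrt_iter_cauchy n p x : (n <= p)%N ->
  rnorm (Y p x - Y n x) <= (1 - y n) * rnorm x.
Proof.
move=> np; apply: (@le_trans _ _ ((y p - y n) * rnorm x)).
  elim: p np => [|p IHp].
    by rewrite leqn0 => /eqP ->; rewrite !subrr rnorm0 mul0r.
  rewrite leq_eqVlt => /predU1P[->|]; first by rewrite !subrr rnorm0 mul0r.
  rewrite ltnS => /IHp np; rewrite -(subrKA (Y p x)).
  apply: le_trans (rnorm_leD _ _) _; have := sqrt_iter_step p x.
  by move: np; rewrite !mulrBl; lra.
rewrite ler_wpM2r ?rnorm_ge0// lerD2r.
by have /andP[] := sqrt_iter1_itv p.
Qed.

Lemma rnorm_rate_eq0 (U : normedModType K) (C : R) (u : U) :
  (forall n, rnorm u <= (1 - y n) * C) -> u = 0.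
Proof.
move=> uC; apply: (@rnorm0_eq0 R k); apply/eqP; rewrite eq_le rnorm_ge0 andbT.
apply/ler_addgt0Pl => e e0; rewrite addr0.
have C0 : 0 < `|C| + 1 by rewrite ltr_wpDl.
have [n] := sqrt_iter1_small (divr_gt0 e0 C0); rewrite ltr_pdivlMr// => ne.
apply: le_trans (uC n) _; apply: le_trans (ltW ne).
have /andP[_ y1] := sqrt_iter1_itv n.
by rewrite ler_wpM2l ?subr_ge0// (le_trans (ler_norm C))// lerDl.
Qed.

Lemma contraction_sqrt : exists S : {linear V -> V},
  is_positive_sqrt S (fun x => x - Q x).
Proof.
have /choice[z zP] : forall x, exists l, forall n,
    rnorm (l - Y n x) <= (1 - y n) * rnorm x.
  move=> x; apply: complete_rate => [n p np|e e0].
    exact: sqrt_iter_cauchy.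
  have C0 : 0 < rnorm x + 1 by rewrite ltr_wpDl ?rnorm_ge0.
  have [n] := sqrt_iter1_small (divr_gt0 e0 C0); rewrite ltr_pdivlMr// => ne.
  exists n; apply: le_lt_trans ne; rewrite ler_wpM2l ?lerDl//.
  by have /andP[_ y1] := sqrt_iter1_itv n; rewrite subr_ge0.
have z1 x : rnorm (z x) <= rnorm x by have := zP x 0; rewrite /= !subr0 mul1r.
have zlin : linear z.
  move=> a x x'; apply/eqP; rewrite -subr_eq0; apply/eqP.
  apply: (@rnorm_rate_eq0 V
    (rnorm (a *: x + x') + rnorm a * rnorm x + rnorm x')) => n.
  have -> : z (a *: x + x') - (a *: z x + z x') =
      (z (a *: x + x') - Y n (a *: x + x')) - a *: (z x - Y n x) -
      (z x' - Y n x').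
    rewrite sqrt_iter_linear scalerBr -[RHS]addrA -opprD addrACA -opprD.
    by rewrite opprB subrKA.
  apply: le_trans (rnorm_leD _ _) _; rewrite rnormN !mulrDr.
  apply: lerD (zP _ _).
  apply: le_trans (rnorm_leD _ _) _; rewrite rnormN; apply: lerD (zP _ _) _.
  by rewrite rnormZ mulrCA ler_wpM2l ?rnorm_ge0.
have zsa x x' : dotv (z x) x' = dotv x (z x').
  apply/eqP; rewrite -subr_eq0; apply/eqP.
  apply: (@rnorm_rate_eq0 K^o (2 * rnorm x * rnorm x')) => n.
  have -> : dotv (z x) x' - dotv x (z x') =
      dotv (z x - Y n x) x' - dotv x (z x' - Y n x').
    by rewrite dotvBl dotvBr sqrt_iter_sa opprB subrKA.
  apply: le_trans (rnorm_leD _ _) _; rewrite rnormN.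
  have h1 := cauchy_schwarz (z x - Y n x) x'.
  have h2 := cauchy_schwarz x (z x' - Y n x').
  have h3 := ler_wpM2r (rnorm_ge0 x') (zP x n).
  have h4 := ler_wpM2l (rnorm_ge0 x) (zP x' n).
  lra.
have zz x : z (z x) = z x + z x - Q x.
  apply/eqP; rewrite -subr_eq0; apply/eqP.
  apply: (@rnorm_rate_eq0 V (4 * rnorm x)) => n.
  have YE : Y n (Y n x) = Y n.+1 x + Y n.+1 x - Q x.
    by rewrite [Y n.+1]/= -scalerDr reals_half_double addrC addrA addNr add0r.
  have -> : z (z x) - (z x + z x - Q x) =
      (z (z x) - Y n (z x)) + Y n (z x - Y n x) -
      ((z x - Y n.+1 x) + (z x - Y n.+1 x)).
    rewrite sqrt_iterB YE subrKA [X in _ = _ - X]addrACA -opprD.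
    by rewrite -[RHS]addrA -opprD [X in _ = _ - X]addrC subrKA.
  apply: le_trans (rnorm_leD _ _) _; rewrite rnormN.
  have h1 := rnorm_leD (z (z x) - Y n (z x)) (Y n (z x - Y n x)).
  have h2 := rnorm_leD (z x - Y n.+1 x) (z x - Y n.+1 x).
  have h3 := zP (z x) n; have h4 := zP x n.+1.
  have h5 := le_trans (sqrt_iter_le1 n _) (zP x n).
  have := sqrt_iter1_le n; have /andP[_ y1] := sqrt_iter1_itv n.
  have := z1 x; have := rnorm_ge0 x; nra.
have slin : linear (fun x => x - z x).
  by move=> a x x'; rewrite zlin scalerBr opprD addrACA.
exists (linear_of slin); split=> [|x x'|x|x]; rewrite /= /linear_of.
- exists 2 => x _; apply: le_trans (rnorm_leD _ _) _; rewrite rnormN.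
  by have := z1 x; lra.
- by rewrite dotvBl dotvBr zsa.
- rewrite -[dotv _ _]conjs_real; last by rewrite -dotv_conj dotvBl dotvBr zsa.
  rewrite -[0](rmorph0 reals) ler_reals dotvBl raddfB/= res_dotvv subr_ge0.
  apply: le_trans (res_le_rnorm _) _; apply: le_trans (cauchy_schwarz _ _) _.
  by rewrite expr2 ler_wpM2r ?rnorm_ge0.
- have zB u v : z (u - v) = z u - z v.
    by rewrite -scaleN1r addrC zlin scaleN1r addrC.
  rewrite zB zz; have -> : z x - (z x + z x - Q x) = Q x - z x.
    by rewrite opprB addrCA opprD addNKr.
  by rewrite opprB addrA subrK.
Qed.

End Contraction.

(** After scaling [T] to a contraction, [Q = 1 - T T'] is a contraction because
    [|T T' x|^2 <= |T' x|^2 = <x, T T' x>]. *)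
Lemma positive_sqrt (V W : hilbertType R k) (T : {linear V -> W})
    (T' : {linear W -> V}) (L : R) : 0 <= L ->
  (forall x y, dotv (T x) y = dotv x (T' y)) ->
  (forall x, rnorm (T x) <= L * rnorm x) ->
  exists S : {linear W -> W}, is_positive_sqrt S (T \o T').
Proof.
move=> L0 TT' TL; pose M := L + 1; have M0 : 0 < M by rewrite ltr_wpDl.
have TM x : rnorm (T x) <= M * rnorm x.
  by apply: le_trans (TL x) _; rewrite ler_wpM2r ?rnorm_ge0// lerDl.
pose c := M ^- 2; have c0 : 0 < c by rewrite invr_gt0 exprn_gt0.
have cM : c * M ^+ 2 = 1 by rewrite mulVf// expf_neq0// gt_eqF.
have Qlin : linear (fun x : W => x - (reals c : K) *: T (T' x)).
  move=> a x y; have -> : T (T' (a *: x + y)) = a *: T (T' x) + T (T' y).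
    by rewrite !linearP.
  by rewrite scalerDr scalerBr opprD addrACA !scalerA mulrC.
have T'T x y : dotv (T' x) y = dotv x (T y).
  by rewrite dotv_conj -TT' -dotv_conj.
have [x y|x|S [[C SC] Ssa S0 SS]] := @contraction_sqrt W (linear_of Qlin).
- rewrite /= /linear_of dotvBl dotvBr dotvZl dotvZr conjs_reals.
  by rewrite TT' T'T.
- rewrite /= /linear_of -(@ler_pXn2r _ 2)// ?nnegrE ?rnorm_ge0//.
  rewrite rnorm_sqB dotvZr conjs_reals res_reals_mul -T'T res_dotvv.
  rewrite rnormZ rnorm_reals exprMn (ger0_norm (ltW c0)).
  have : rnorm (T (T' x)) ^+ 2 <= M ^+ 2 * rnorm (T' x) ^+ 2.
    by rewrite -exprMn ler_pXn2r ?nnegrE ?mulr_ge0 ?rnorm_ge0 ?(ltW M0).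
  move=> /(ler_wpM2l (sqr_ge0 c)).
  rewrite [c ^+ 2 * (M ^+ 2 * _)]mulrA [c ^+ 2 * M ^+ 2](_ : _ = c); last first.
    by rewrite expr2 -mulrA cM mulr1.
  by have := mulr_ge0 (ltW c0) (sqr_ge0 (rnorm (T' x))); lra.
have Slin : linear (fun x => (reals M : K) *: S x).
  move=> a x y; have -> : S (a *: x + y) = a *: S x + S y by rewrite linearP.
  by rewrite scalerDr !scalerA mulrC.
exists (linear_of Slin); split=> [|x y|x|x]; rewrite /= /linear_of.
- exists (M * C) => x Dx; rewrite rnormZ rnorm_reals gtr0_norm// -mulrA.
  by rewrite ler_pM2l// SC.
- by rewrite dotvZl dotvZr conjs_reals Ssa.
- by rewrite dotvZl mulr_ge0// -[0](rmorph0 reals) ler_reals ltW.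
- rewrite linearZ/= SS /= /linear_of scalerA -rmorphM/= -expr2 opprB.
  rewrite addrC subrK scalerA -rmorphM/= mulrC cM.
  by rewrite rmorph1 scale1r.
Qed.

End SquareRoot.

(** * Uniform boundedness *)

Section WeaklyBounded.
Variables (R : realType) (k : scalar_kind) (V : hilbertType R k).
Local Notation K := (scalar R k).

(** A step [h] along [y] of length [r] changes the product with [y] by
    [r * rnorm y], so at least one of [x + h] and [x - h] has a product of at
    least that size. *)
Lemma dotv_perturbation (r : R) (x y : V) : 0 <= r ->
  exists2 x', rnorm (x' - x) <= r & r * rnorm y <= rnorm (dotv x' y).
Proof.
move=> r0; have [->|y0] := eqVneq y 0.
  by exists x; rewrite ?subrr ?rnorm0// mulr0 rnorm_ge0.
have yp := rnorm_gt0 y0.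
pose h := (reals (r / rnorm y) : K) *: y.
have hr : rnorm h = r.
  by rewrite rnormZ rnorm_reals ger0_norm ?divr_ge0 ?(ltW yp)// divfK// gt_eqF.
have hy : rnorm (dotv h y) = r * rnorm y.
  rewrite dotvZl rnormM dotvv_rnorm !rnorm_reals.
  rewrite !ger0_norm ?sqr_ge0 ?divr_ge0 ?(ltW yp)//.
  by rewrite expr2 mulrA divfK// gt_eqF.
have [le|/ltW ge] := leP (r * rnorm y) (rnorm (dotv (x + h) y)).
  by exists (x + h) => //; rewrite addrC addKr hr.
exists (x - h); first by rewrite addrC addKr rnormN hr.
have : rnorm (dotv h y + dotv h y) <=
    rnorm (dotv (x + h) y) + rnorm (dotv (x - h) y).
  rewrite -[rnorm (dotv (x - h) y)]rnormN; apply: le_trans (rnorm_leD _ _).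
  by rewrite dotvBl dotvDl opprB [dotv x y + _]addrC addrACA subrr addr0.
have -> : rnorm (dotv h y + dotv h y) = 2 * rnorm (dotv h y).
  have -> : dotv h y + dotv h y = reals 2 * dotv h y.
    by rewrite (rmorph_nat (@reals R k) 2) mulr_natl mulr2n.
  by rewrite rnormM rnorm_reals ger0_norm.
rewrite hy; lra.
Qed.

(** Gliding hump: if some [y n] in [Y] has norm above [2 (n + 1) 3^n], move
    successively by steps of length [3^-n] to make the product with [y n] at
    least [3^-n * rnorm (y n)]. The later steps have total length at most
    [3^-n / 2], so at least half of that product survives in the limit, which
    is then not bounded on [Y]. *)
Lemma weakly_bounded_bounded (Y : set V) :
  (forall x, exists b : R, forall y, Y y -> rnorm (dotv x y) <= b) ->
  exists L : R, forall y, Y y -> rnorm y <= L.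
Proof.
move=> wb; apply: contrapT => unb.
have [r [r0 rS rsmall]] : exists r : nat -> R, [/\ forall n, 0 < r n,
    forall n, r n.+1 = r n / 3 & forall n, r n <= n.+1%:R^-1].
  exists (fun n => 3 ^- n); split=> n; first by rewrite invr_gt0 exprn_gt0.
    by rewrite exprS invfM mulrC.
  by rewrite lef_pV2 ?posrE ?exprn_gt0// -natrX ler_nat; exact: ltn_expl.
have /choice[y yP] : forall n, exists y, Y y /\ 2 * n.+1%:R / r n < rnorm y.
  move=> n; apply: contrapT => ny; apply: unb.
  exists (2 * n.+1%:R / r n) => y Yy.
  by rewrite leNgt; apply/negP => lt; apply: ny; exists y.
have /choice[next nextP] : forall p : nat * V, exists x',
    rnorm (x' - p.2) <= r p.1 /\
    r p.1 * rnorm (y p.1) <= rnorm (dotv x' (y p.1)).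
  move=> [n x] /=.
  by have [x' ? ?] := dotv_perturbation x (y n) (ltW (r0 n)); exists x'.
pose x := fix x n := if n is m.+1 then next (m, x m) else 0.
have [n p np|e e0|l lP] := @complete_rate R k V x (fun n => 3 / 2 * r n).
- apply: (@le_trans _ _ (3 / 2 * (r n - r p))); last first.
    by rewrite ler_pM2l// lerBlDr lerDl ltW.
  elim: p np => [|p IHp].
    by rewrite leqn0 => /eqP ->; rewrite !subrr rnorm0 mulr0.
  rewrite leq_eqVlt => /predU1P[->|]; first by rewrite !subrr rnorm0 mulr0.
  rewrite ltnS => /IHp np; rewrite -(subrKA (x p)).
  apply: le_trans (rnorm_leD _ _) _.
  have h : rnorm (x p.+1 - x p) <= r p := (nextP (p, x p)).1.
  move: np h; rewrite rS; lra.
- have [n ne] := invr_nat_lt (divr_gt0 e0 (ltr0n R 2)).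
  exists n; have := le_lt_trans (rsmall n) ne; have := r0 n.
  by move: (r n) => t; lra.
have [b bP] := wb l.
have [n bn] : exists n : nat, b < n.+1%:R.
  by exists (Num.trunc b); exact: truncnS_gt.
have [Yn yn] := yP n; have := bP _ Yn.
have [_] := nextP (n, x n); rewrite [next _]/(x n.+1) /= => big.
have lx := lP n.+1; rewrite rS in lx.
have := cauchy_schwarz (l - x n.+1) (y n).
have : rnorm (dotv (x n.+1) (y n)) <=
    rnorm (dotv (l - x n.+1) (y n)) + rnorm (dotv l (y n)).
  rewrite -[rnorm (dotv (l - _) _)]rnormN -dotvNl opprB.
  apply: le_trans (rnorm_leD _ _).
  by rewrite -dotvDl subrK.
move: yn; rewrite ltr_pdivrMr// => yn.
have := ler_wpM2r (rnorm_ge0 (y n)) lx.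
have r1 := r0 n; move: big yn bn; move: (n.+1%:R : R) => N.
lra.
Qed.

End WeaklyBounded.

(** * Infinite-dimensional subspaces *)

Section Dimension.
Variables (R : realType) (k : scalar_kind).
Local Notation K := (scalar R k).

(** Separation by finitely many functionals passes to all subspaces and to
    orthogonality conditions, which makes it a more flexible criterion for
    finite dimension than spanning families: restrict to the kernel of one
    functional, and add back one vector outside that kernel if there is one. *)
Lemma finite_dim_separated (V : normedModType K) n (phi : 'I_n -> V -> K)
    (E : set V) :
  linear_subspace E ->
  (forall i a x y, phi i (a *: x + y) = a * phi i x + phi i y) ->
  (forall x, E x -> (forall i, phi i x = 0) -> x = 0) -> finite_dim E.
Proof.
elim: n phi E => [|n IHn] phi E [E0 ED] philin phi0.
  exists 0, (fun=> 0); split; first by case.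
  by move=> x Ex; exists (fun=> 0); rewrite big_ord0; apply: phi0 => // -[].
have phi00 : phi ord0 0 = 0.
  by have := philin ord0 (-1) 0 0; rewrite scaler0 addr0 mulN1r addNr.
have [m [e [Ee eP]]] : finite_dim [set x | E x /\ phi ord0 x = 0].
  apply: (IHn (fun i => phi (lift ord0 i))).
  - split=> // a x y [Ex x0] [Ey y0]; split; first exact: ED.
    by rewrite philin x0 y0 mulr0 addr0.
  - by move=> i; exact: philin.
  - move=> x [Ex x0] hx; apply: phi0 => // i.
    by case: (unliftP ord0 i) => [j|] ->.
have [[e0 [Ee0 e00]]|ne] := pselect (exists e0, E e0 /\ phi ord0 e0 != 0).
  exists m.+1, (fun i => if unlift ord0 i is Some j then e j else e0); split.
    by move=> i; case: unliftP => [j _|_//]; exact: (Ee j).1.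
  move=> x Ex; pose c := phi ord0 x / phi ord0 e0.
  have [|d dP] := eP (x - c *: e0).
    split; first by rewrite addrC -scaleNr; exact: ED.
    by rewrite addrC -scaleNr philin /c mulNr divfK// addNr.
  exists (fun i => if unlift ord0 i is Some j then d j else c).
  rewrite big_ord_recl unlift_none; under eq_bigr do rewrite !liftK.
  by rewrite -dP addrC subrK.
exists m, e; split; first by move=> i; exact: (Ee i).1.
move=> x Ex; apply: eP; split => //; apply/eqP; apply: contrapT => /negP x0.
by apply: ne; exists x.
Qed.

(** The functionals [dotv _ (e i)] separate the points of [E], because a vector
    of [E] orthogonal to all [e i] is orthogonal to itself. *)
Lemma finite_dim_spanned (V : preHilbertType R k) n (e : 'I_n -> V)
    (E : set V) : linear_subspace E ->
  (forall x, E x -> exists c : 'I_n -> K, x = \sum_(i < n) c i *: e i) ->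
  finite_dim E.
Proof.
move=> Elin Ee.
apply: (@finite_dim_separated V n (fun i x => dotv x (e i))) => //.
  by move=> i a x y; rewrite dotvDl dotvZl.
move=> x Ex x0; have [c xE] := Ee x Ex; apply: (@dotvv_eq0 R k).
rewrite {2}xE; elim/big_ind: _ => [|y z y0 z0|i _]; first by rewrite dotv0r.
  by rewrite dotvDr y0 z0 addr0.
by rewrite dotvZr x0 mulr0.
Qed.

Lemma infinite_dimS (V : preHilbertType R k) (D E : set V) :
  linear_subspace D -> D `<=` E -> infinite_dim D -> infinite_dim E.
Proof.
move=> Dlin DE Dinf [n [e [_ eP]]]; apply: Dinf.
by apply: (@finite_dim_spanned _ n e) => // x /DE/eP.
Qed.

Lemma infinite_dim_orth (V : preHilbertType R k) (E : set V) n (g : 'I_n -> V) :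
  linear_subspace E -> infinite_dim E ->
  exists e, [/\ E e, e != 0 & forall i, dotv e (g i) = 0].
Proof.
move=> Elin Einf; apply: contrapT => ne; apply: Einf.
apply: (@finite_dim_separated V n (fun i x => dotv x (g i))) => //.
  by move=> i a x y; rewrite dotvDl dotvZl.
by move=> x Ex xg; apply/eqP; apply: contrapT => /negP x0; apply: ne; exists x.
Qed.

End Dimension.

(** * Embedding a separable space into an infinite-dimensional one *)

Section Embedding.
Variables (R : realType) (k : scalar_kind).
Local Notation K := (scalar R k).

Definition comb (V : lmodType K) (d : nat -> V) (c : nat -> K) n : V :=
  \sum_(i < n) c i *: d i.

Lemma dotv_comb (V W : preHilbertType R k) (d : nat -> V) (g : nat -> W)
    c c' n :
  (forall i j, (i < n)%N -> (j < n)%N -> dotv (g i) (g j) = dotv (d i) (d j)) ->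
  dotv (comb g c n) (comb g c' n) = dotv (comb d c n) (comb d c' n).
Proof.
move=> gd; rewrite /comb.
have suml (U : preHilbertType R k) (e : nat -> U) (u : U) a :
    dotv (\sum_(i < n) a i *: e i) u = \sum_(i < n) a i * dotv (e i) u.
  elim/big_rec2: _ => [|i p q _ <-]; first by rewrite dotv0l.
  by rewrite dotvDl dotvZl.
have sumr (U : preHilbertType R k) (e : nat -> U) (u : U) a :
    dotv u (\sum_(i < n) a i *: e i) = \sum_(i < n) conjs (a i) * dotv u (e i).
  elim/big_rec2: _ => [|i p q _ <-]; first by rewrite dotv0r.
  by rewrite dotvDr dotvZr.
rewrite !suml; apply: eq_bigr => i _; rewrite !sumr; congr (_ * _).
by apply: eq_bigr => j _; rewrite gd.
Qed.

Lemma comb_lin (V : lmodType K) (d : nat -> V) a c c' n :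
  comb d (fun i => a * c i + c' i) n = a *: comb d c n + comb d c' n.
Proof.
rewrite /comb scaler_sumr -big_split; apply: eq_bigr => i _.
by rewrite scalerDl scalerA.
Qed.

Lemma comb_delta (V : lmodType K) (d : nat -> V) n m : (m < n)%N ->
  comb d (fun i => (i == m)%:R) n = d m.
Proof.
move=> mn; rewrite /comb (bigD1 (Ordinal mn))//= eqxx scale1r big1 ?addr0//.
move=> i /negPf; rewrite -val_eqE/= => ->; exact: scale0r.
Qed.

Lemma comb_widen (V : lmodType K) (d : nat -> V) c n m : (n <= m)%N ->
  comb d (fun i => if (i < n)%N then c i else 0) m = comb d c n.
Proof.
move=> nm; rewrite /comb (big_ord_widen _ (fun i => c i *: d i) nm).
rewrite [RHS]big_mkcond.
by apply: eq_bigr => i _; case: ifP => // _; rewrite scale0r.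
Qed.

Definition comb_rel (V W : lmodType K) (d : nat -> V) (g : nat -> W) n
  (v : V) (w : W) := exists c, v = comb d c n /\ w = comb g c n.

(** The next vector is the image, under the isometry between the spans that is
    already built, of the projection [w] of [d n] onto the span, plus a vector
    of [E] orthogonal to the previous [g i] with the norm of [d n - w]. Taking
    [w] in the closure of the span avoids closedness of finite-dimensional
    subspaces. *)
Lemma gram_step (V W : hilbertType R k) (E : set W) (d : nat -> V)
    (g : nat -> W) n :
  linear_subspace E -> closed E -> infinite_dim E ->
  (forall i, (i < n)%N -> E (g i)) ->
  (forall i j, (i < n)%N -> (j < n)%N -> dotv (g i) (g j) = dotv (d i) (d j)) ->
  exists y, [/\ E y, dotv y y = dotv (d n) (d n) &
    forall i, (i < n)%N -> dotv y (g i) = dotv (d n) (d i)].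
Proof.
move=> Elin Ecl Einf Eg gd; have [E0 ED] := Elin.
pose G := comb_rel d g n.
have Glin : linear_relation G.
  split=> [|a v w v' w' [c [-> ->]] [c' [-> ->]]]; last first.
    by exists (fun i => a * c i + c' i); rewrite !comb_lin.
  by exists (fun=> 0); rewrite /comb !big1// => i _; rewrite scale0r.
have Gdg i : (i < n)%N -> G (d i) (g i).
  by move=> ni; exists (fun j => (j == i)%:R); rewrite !comb_delta.
have GE : rel_ran G `<=` E.
  move=> _ [_ [c [_ ->]]]; rewrite /comb; elim/big_ind: _ => // [x y Ex Ey|i _].
    by have := ED 1 _ _ Ex Ey; rewrite scale1r.
  by have := ED (c i) _ _ (Eg i (ltn_ord i)) E0; rewrite addr0.
have [|T [T' [TT' _ TG Tran Tiso]]] := isometric_extension Glin.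
  by move=> _ _ _ _ [c [-> ->]] [c' [-> ->]]; exact: dotv_comb.
have [w domw dw] := orthogonal_projection (d n) (rel_dom_subspace Glin).
have [e [Ee e0 eg]] := @infinite_dim_orth R k W E n (fun i => g i) Elin Einf.
have ep := rnorm_gt0 e0.
have Te : dotv (T w) e = 0.
  apply: dotv_closure0 (Tran w) _ => _ [_ [c [_ ->]]]; rewrite /comb.
  elim/big_ind: _ => [|x y x0 y0|i _]; first by rewrite dotv0l.
    by rewrite dotvDl x0 y0 addr0.
  by rewrite dotvZl dotv_conj eg rmorph0 mulr0.
have ew : dotv w (d n - w) = 0 := dotv_closure0 domw dw.
pose r := rnorm (d n - w) / rnorm e.
exists (T w + (reals r : K) *: e); split.
- rewrite addrC; apply: ED => //.
  by rewrite ((closure_id E).1 Ecl); exact: closureS (Tran w).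
- rewrite !dotvv_rnorm; congr (reals _).
  rewrite rnorm_sqD dotvZr Te mulr0 raddf0 mulr0 addr0.
  rewrite rnormZ rnorm_reals ger0_norm ?divr_ge0 ?rnorm_ge0// divfK ?gt_eqF//.
  rewrite -res_dotvv Tiso// res_dotvv.
  have dn : d n = w + (d n - w) by rewrite addrC subrK.
  by rewrite [in RHS]dn [RHS]rnorm_sqD ew raddf0 mulr0 addr0.
- move=> i ni; rewrite dotvDl dotvZl (eg (Ordinal ni)) mulr0 addr0.
  rewrite -(TG _ _ (Gdg i ni)) Tiso//; last first.
    by apply: subset_closure; exists (g i); exact: Gdg.
  apply/eqP; rewrite eq_sym -subr_eq0 -dotvBl dotv_conj dw ?rmorph0//.
  by exists (g i); exact: Gdg.
Qed.

(** Copying a Gram matrix one vector at a time does the work of orthonormal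
    bases of both spaces. *)
Lemma gram_copy (V W : hilbertType R k) (E : set W) (d : nat -> V) :
  linear_subspace E -> closed E -> infinite_dim E ->
  exists g : nat -> W, (forall i, E (g i)) /\
    forall i j, dotv (g i) (g j) = dotv (d i) (d j).
Proof.
move=> Elin Ecl Einf.
pose good n (g : nat -> W) := (forall i, (i < n)%N -> E (g i)) /\
  forall i j, (i < n)%N -> (j < n)%N -> dotv (g i) (g j) = dotv (d i) (d j).
have /choice[next nextP] : forall p : nat * (nat -> W), exists y,
    good p.1 p.2 -> [/\ E y, dotv y y = dotv (d p.1) (d p.1) &
    forall i, (i < p.1)%N -> dotv y (p.2 i) = dotv (d p.1) (d i)].
  move=> [n g] /=; have [[Eg gd]|ng] := pselect (good n g); last by exists 0.
  by have [y yP] := gram_step Elin Ecl Einf Eg gd; exists y.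
(* [G n] carries the first [n] chosen vectors; its later values are 0. *)
pose G := fix G n : nat -> W := if n is m.+1 then
  fun i => if i == m then next (m, G m) else G m i else fun=> 0.
have GS n i : G n.+1 i = if i == n then next (n, G n) else G n i by [].
have Ggood n : good n (G n).
  elim: n => [|n IHn]; first by split.
  have [En nn ng] := nextP (n, G n) IHn; have [Eg gd] := IHn.
  split=> [i|i j]; rewrite !ltnS !GS.
    by rewrite leq_eqVlt; case: eqP => //= _; exact: Eg.
  rewrite (leq_eqVlt i) (leq_eqVlt j); case: (eqVneq i n) => /= [->|_ ni].
    by case: (eqVneq j n) => /= [->//|_ _ nj]; exact: ng.
  case: (eqVneq j n) => /= [-> _|_ nj]; last exact: gd.
  by rewrite dotv_conj ng// -dotv_conj.
have GE m i : (i < m)%N -> G m i = G i.+1 i.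
  elim: m => // m IHm; rewrite ltnS leq_eqVlt => /predU1P[->//|im].
  by rewrite GS ltn_eqF// IHm.
exists (fun i => G i.+1 i); split=> [i|i j]; first exact: (Ggood i.+1).1.
rewrite -(GE (maxn i j).+1) ?ltnS ?leq_maxl//.
rewrite -(GE (maxn i j).+1 j) ?ltnS ?leq_maxr//.
by rewrite (Ggood _).2// ltnS ?leq_maxl ?leq_maxr.
Qed.

Lemma separable_seq (V : normedModType K) : separable V ->
  exists d : nat -> V, forall x (e : R), 0 < e -> exists n, rnorm (x - d n) < e.
Proof.
move=> [A cA dA].
have /countable_injP[h hinj] := cA.
have /choice[d dP] : forall n, exists x, forall a, A a -> h a = n -> x = a.
  move=> n; have [[a [Aa ha]]|na] := pselect (exists a, A a /\ h a = n).
    by exists a => b Ab hb; apply: hinj; rewrite ?inE// ha.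
  by exists 0 => a Aa ha; exfalso; apply: na; exists a.
exists d => x e e0.
have re0 : (0 : K) < reals e by rewrite -[0](rmorph0 reals) ltr_reals.
have [] := dA (interior (ball x (reals e))).
- by exists x; exact: nbhsx_ballx.
- exact: open_interior.
move=> a [/interior_subset xa Aa]; exists (h a); rewrite (dP (h a) a)//.
by move: xa; rewrite -ball_normE/= -reals_rnorm ltr_reals.
Qed.

(** Copying the Gram matrix of a dense sequence of [V] inside [E] defines an
    isometric relation with dense domain. *)
Lemma separable_embedding (V W : hilbertType R k) (E : set W) :
  separable V -> linear_subspace E -> closed E -> infinite_dim E ->
  exists (U : {linear V -> W}) (U' : {linear W -> V}),
    [/\ forall x y, dotv (U x) y = dotv x (U' y),
        forall x, rnorm (U x) <= rnorm x,
        forall x y, dotv (U x) (U y) = dotv x y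
      & forall x, E (U x)].
Proof.
move=> /separable_seq[d dd] Elin Ecl Einf; have [E0 ED] := Elin.
have [g [Eg gd]] := gram_copy d Elin Ecl Einf.
pose G v w := exists n, comb_rel d g n v w.
have Gwiden n m v w : (n <= m)%N -> comb_rel d g n v w -> comb_rel d g m v w.
  move=> nm [c [-> ->]]; exists (fun i => if (i < n)%N then c i else 0).
  by rewrite !comb_widen.
have Glin : linear_relation G.
  split=> [|a v w v' w' [n vw] [n' vw']].
    by exists 0%N, (fun=> 0); rewrite /comb !big_ord0.
  have [c [-> ->]] := Gwiden _ _ _ _ (leq_maxl n n') vw.
  have [c' [-> ->]] := Gwiden _ _ _ _ (leq_maxr n n') vw'.
  by exists (maxn n n'), (fun i => a * c i + c' i); rewrite !comb_lin.
have [|U [U' [UU' U1 UG Uran Uiso]]] := isometric_extension Glin.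
  move=> v w v' w' [n vw] [n' vw'].
  have [c [-> ->]] := Gwiden _ _ _ _ (leq_maxl n n') vw.
  have [c' [-> ->]] := Gwiden _ _ _ _ (leq_maxr n n') vw'.
  by apply: dotv_comb => i j _ _.
have domT x : closure (rel_dom G) x.
  apply/closure_rnorm => e /(dd x)[n xn]; exists (d n) => //.
  exists (g n), n.+1; by exists (fun i => (i == n)%:R); rewrite !comb_delta.
exists U, U'; split => // x; first by move=> y; exact: Uiso.
rewrite ((closure_id E).1 Ecl); apply: closureS (Uran x).
move=> _ [_ [n [c [_ ->]]]]; rewrite /comb.
elim/big_ind: _ => // [y z Ey Ez|i _].
  by have := ED 1 _ _ Ey Ez; rewrite scale1r.
by have := ED (c i) _ _ (Eg i) E0; rewrite addr0.
Qed.

End Embedding.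

(** * Automatic boundedness of linear relations *)

Section WeakRelation.
Variables (R : realType) (k : scalar_kind).
Local Notation K := (scalar R k).

(** For [rnorm v = 0] all multiples of [w] are bounded by [L], so [w] is 0. *)
Lemma linear_relation_bound (V W : normedModType K) (G : V -> W -> Prop)
    (L : R) :
  linear_relation G -> (forall v w, G v w -> rnorm v <= 1 -> rnorm w <= L) ->
  forall v w, G v w -> rnorm w <= L * rnorm v.
Proof.
move=> Glin GL v w Gvw.
have scaled (t : R) : 0 <= t -> t * rnorm v <= 1 -> t * rnorm w <= L.
  move=> t0; have := GL _ _ (linear_relationZ (reals t) Glin Gvw).
  by rewrite !rnormZ rnorm_reals ger0_norm.
have v0 := rnorm_ge0 v; have w0 := rnorm_ge0 w.
have L0 : 0 <= L by have := scaled 0 (lexx 0); rewrite !mul0r; apply.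
have [vz|vn0] := eqVneq (rnorm v) 0; last first.
  have vp : 0 < rnorm v by rewrite lt_def vn0.
  rewrite -ler_pdivrMr// mulrC; apply: scaled; first by rewrite invr_ge0.
  by rewrite mulVf.
rewrite vz mulr0 leNgt; apply/negP => wp.
have := scaled ((L + 1) / rnorm w) (divr_ge0 (addr_ge0 L0 ler01) w0).
rewrite vz mulr0 ler01 divfK ?gt_eqF// => /(_ isT).
by rewrite gerDl leNgt ltr01.
Qed.

(** Uniform boundedness in the form that replaces the closed graph and open
    mapping theorems: it suffices to bound each coordinate of the relation. *)
Lemma weakly_bounded_relation (V : normedModType K) (W : hilbertType R k)
    (G : V -> W -> Prop) :
  linear_relation G ->
  (forall x, exists b : R,
     forall v w, G v w -> rnorm (dotv x w) <= b * rnorm v) ->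
  exists2 L : R, 0 <= L & forall v w, G v w -> rnorm w <= L * rnorm v.
Proof.
move=> Glin wb.
have [x|L LP] := @weakly_bounded_bounded R k W
    [set w | exists v, G v w /\ rnorm v <= 1].
  have [b bP] := wb x; exists `|b| => w [v [Gvw v1]].
  apply: le_trans (bP _ _ Gvw) _; apply: le_trans (_ : `|b| * rnorm v <= _).
    by rewrite ler_wpM2r ?rnorm_ge0 ?ler_norm.
  by rewrite ler_piMr.
exists `|L| => // v w Gvw.
apply: le_trans (_ : L * rnorm v <= _).
  apply: linear_relation_bound Gvw => // v' w' Gvw' v1; apply: LP.
  by exists v'.
by rewrite ler_wpM2r ?rnorm_ge0 ?ler_norm.
Qed.

End WeakRelation.

(** * The analysis operator on a subspace where it is bounded below *)

Section Analysis.
Variables (R : realType) (k : scalar_kind) (H : hilbertType R k) (f : nat -> H).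
Local Notation K := (scalar R k).
Local Notation l2 := (l2 R k).
Implicit Types (a : l2) (x : H) (D : set H).

(** The graph of the analysis operator, with no domain to carry around. *)
Definition coeffs x a := forall n, a n = dotv x (f n).

Lemma coeffs_exists x :
  square_summable (fun n => dotv x (f n)) -> exists a, coeffs x a.
Proof. by move=> xf; exists (L2 (asboolT xf)). Qed.

Lemma coeffs_sqsum x a : coeffs x a ->
  sqsum (fun n => dotv x (f n)) = (rnorm a ^+ 2)%:E.
Proof.
move=> xa; rewrite l2_rnormE -sqsumE; last exact: l2P.
by congr sqsum; apply/funext => n; rewrite -xa.
Qed.

Lemma coeffs_dom x a : coeffs x a -> analysis_dom f x.
Proof.
by move=> xa; rewrite /analysis_dom/= /square_summable (coeffs_sqsum xa) ltry.
Qed.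

Lemma analysis_rangeE a : analysis_range f a <-> exists x, coeffs x a.
Proof.
split=> [[x [xf ->]]|[x xa]]; first by exists x.
by exists x, (coeffs_dom xa); apply: l2_ext => n; rewrite xa.
Qed.

Lemma coeffs_inj x a b : coeffs x a -> coeffs x b -> a = b.
Proof. by move=> xa xb; apply: l2_ext => n; rewrite xa xb. Qed.

Lemma coeffs_linear c x y a b :
  coeffs x a -> coeffs y b -> coeffs (c *: x + y) (c *: a + b).
Proof.
by move=> xa yb n; rewrite l2_addE l2_scaleE xa yb dotvDl dotvZl.
Qed.

Lemma coeffs0 : coeffs 0 0.
Proof. by move=> n; rewrite dotv0l. Qed.

Lemma l2_coord_le a n : rnorm (a n : K) <= rnorm a.
Proof.
rewrite l2_rnormE -(@ler_pXn2r _ 2)// ?nnegrE ?rnorm_ge0 ?sqnorm_ge0//.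
apply: le_trans (psum_le_sqnorm n.+1 (l2P a)).
by rewrite big_nat_recr//= lerDr psum_ge0.
Qed.

Definition bounded_below D (L : R) :=
  forall x, D x -> exists2 a, coeffs x a & rnorm x <= L * rnorm a.

Lemma lower_boundE D : has_lower_bound_on f D <->
  [/\ linear_subspace D, infinite_dim D
    & exists2 L : R, 0 <= L & bounded_below D L].
Proof.
split=> [[Dlin Dinf [A A0 DA]]|[Dlin Dinf [L L0 DL]]]; split => //.
  exists (Num.sqrt A^-1) => [|x /DA /andP[Ax xoo]]; first exact: sqrtr_ge0.
  have [a xa] := coeffs_exists xoo; exists a => //.
  rewrite -(@ler_pXn2r _ 2)// ?nnegrE ?mulr_ge0 ?rnorm_ge0 ?sqrtr_ge0//.
  rewrite exprMn sqr_sqrtr ?invr_ge0 ?(ltW A0)//.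
  by rewrite ler_pdivlMl// -lee_fin -(coeffs_sqsum xa).
have M0 : 0 < L ^+ 2 + 1 by rewrite ltr_wpDl ?sqr_ge0.
exists (L ^+ 2 + 1)^-1 => [|x /DL[a xa xL]]; first by rewrite invr_gt0.
rewrite (coeffs_sqsum xa) ltry andbT lee_fin ler_pdivrMl//.
have : rnorm x ^+ 2 <= (L * rnorm a) ^+ 2.
  by rewrite ler_pXn2r// ?nnegrE ?mulr_ge0 ?rnorm_ge0.
by have := sqr_ge0 (rnorm a); rewrite exprMn; lra.
Qed.

(** The inverse of the analysis operator on [D] extends to a bounded operator
    [T] on [l2]. As the analysis operator is closed, [T a] has coefficients [a]
    for every [a] in the closure [M] of the set of coefficients of [D], so [M]
    is a closed subspace of the range of the analysis operator. *)
Lemma bounded_left_inverse D : has_lower_bound_on f D ->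
  exists (T : {linear l2 -> H}) (T' : {linear H -> l2}) (M : set l2),
    [/\ [/\ linear_subspace M, closed M & infinite_dim M],
        exists2 L : R, 0 <= L & forall a, rnorm (T a) <= L * rnorm a,
        forall a y, dotv (T a) y = dotv a (T' y),
        (forall y, M (T' y)) /\ (forall a, M a -> coeffs (T a) a)
      & D `<=` [set T a | a in setT] /\ forall a, closure D (T a)].
Proof.
move=> /lower_boundE[Dlin Dinf [L L0 DL]]; have [D0 DD] := Dlin.
pose G a x := D x /\ coeffs x a.
have Glin : linear_relation G.
  split=> [|c a x a' x' [Dx xa] [Dx' xa']]; first by split=> //; exact: coeffs0.
  by split; [exact: DD | exact: coeffs_linear].
have [a x [Dx xa]|T [T' [TT' TL TG Tran T'dom]]] := bounded_extension L0 Glin.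
  by have [b xb] := DL x Dx; rewrite (coeffs_inj xa xb).
have Tcoeffs a : closure (rel_dom G) a -> coeffs (T a) a.
  move=> Ma n; apply/eqP; rewrite -subr_eq0; apply/eqP.
  apply: (@closure_vanish R k _ K^o _ (fun a => (a n : K) - dotv (T a) (f n))
    (1 + L * rnorm (f n)) _ _ _ _ Ma).
  - move=> b c; rewrite linearB dotvBl [(b - c) n]/(b n - c n : K).
    by rewrite opprD addrACA -opprD.
  - move=> b; apply: le_trans (rnorm_leD _ _) _; rewrite rnormN mulrDl mul1r.
    apply: lerD (l2_coord_le b n) _; apply: le_trans (cauchy_schwarz _ _) _.
    by rewrite mulrAC ler_wpM2r ?rnorm_ge0.
  - by move=> b [x [Dx xb]]; rewrite (TG b x)// xb subrr.
exists T, T', (closure (rel_dom G)); split => //.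
- split; first exact/subspace_closure/rel_dom_subspace.
    exact: closed_closure.
  move=> [n [e [_ eP]]]; apply: Dinf.
  apply: (@finite_dim_spanned R k H n (fun i => T (e i))) => // x Dx.
  have [a xa _] := DL x Dx.
  have [c ac] := eP a (subset_closure (ex_intro _ x (conj Dx xa))).
  exists c; rewrite -(TG a x)// ac linear_sum; apply: eq_bigr => i _.
  by rewrite linearZ.
- by exists L.
- split=> [x Dx|a].
    by have [a xa _] := DL x Dx; exists a => //; exact: TG.
  by apply: closureS (Tran a) => x [b []].
Qed.

(** With [S = (T T')^(1/2)], the identity [|S z| = |T' z|] gives an isometry [U]
    with [U S = T'] (polar decomposition). On the closure of the range of [S],
    which is the closure of [D], the coefficients of [S x] are [U x]: this holds
    at [x = S z], where [S x = T (T' z)], and extends by continuity. Hence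
    [sum |<x, S f_n>|^2 = |U x|^2 = |x|^2]. The range of [S] contains [D]
    because [|<y, T a>| <= |a| |S y|] makes [S y |-> <y, T a>] a bounded
    functional. *)
Lemma parseval_sqrt D : has_lower_bound_on f D ->
  exists (T : {linear l2 -> H}) (T' : {linear H -> l2}) (S : {linear H -> H}),
    [/\ bounded_on setT T,
        forall a y, dotv (T a) y = dotv a (T' y),
        is_positive_sqrt S (T \o T'),
        (forall n, closure D (S (f n))) /\ parseval_frame (closure D) (S \o f)
      & (forall x, D x -> exists w, S w = x) /\
        forall x, S x = 0 -> forall d, D d -> dotv d x = 0].
Proof.
move=> DB; have [Dlin _ _] := DB.
have [T [T' [M [_ [L L0 TL] TT' [MT' Mcoeffs] [DT TD]]]]] :=
  bounded_left_inverse DB.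
have [S SP] := positive_sqrt L0 TT' TL; have [[C SC] Ssa S0 SS] := SP.
have ST' x y : dotv (T' x) (T' y) = dotv (S x) (S y).
  by rewrite Ssa SS /= dotv_conj -TT' -dotv_conj.
have rST x : rnorm (T' x) = rnorm (S x).
  apply/eqP; rewrite -(@eqrXn2 _ 2) ?rnorm_ge0//.
  by rewrite -!res_dotvv ST'.
have S0D x : S x = 0 -> forall d, D d -> dotv d x = 0.
  move=> Sx0 d /DT[a _ <-]; rewrite TT' (_ : T' x = 0) ?dotv0r//.
  by apply: (@rnorm0_eq0 R k); rewrite rST Sx0 rnorm0.
have ranS : closure D `<=` closure [set S x | x in setT].
  move=> x Dx; apply: closure_orth => [|z zS].
    split; first by exists 0; rewrite ?linear0.
    by move=> c _ _ [y _ <-] [y' _ <-]; exists (c *: y + y'); rewrite ?linearP.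
  apply: dotv_closure0 Dx _; apply: S0D; apply: (@dotvv_eq0 R k).
  by rewrite -Ssa; apply: zS; exists (S z).
have SD n : closure D (S (f n)).
  apply: closure_orth => // z Dz; rewrite Ssa (_ : S z = 0) ?dotv0r//.
  apply: (@rnorm0_eq0 R k); rewrite -rST (_ : T' z = 0) ?rnorm0//.
  by apply: (@dotvv_eq0 R k); rewrite -TT'; exact: dotv_closure0 (TD _) Dz.
pose G v a := exists z, v = S z /\ a = T' z.
have Glin : linear_relation G.
  split=> [|c _ _ _ _ [y [-> ->]] [y' [-> ->]]].
    by exists 0; rewrite !linear0.
  by exists (c *: y + y'); rewrite !linearP.
have [|U [_ [_ U1 UG _ Uiso]]] := isometric_extension Glin.
  by move=> _ _ _ _ [y [-> ->]] [y' [-> ->]].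
have domG x : closure D x -> closure (rel_dom G) x.
  by move=> /ranS; apply: closureS => _ [y _ <-]; exists (T' y), y.
have Ucoeffs x : closure D x -> coeffs (S x) (U x).
  move=> /domG Dx n; apply/eqP; rewrite -subr_eq0; apply/eqP.
  apply: (@closure_vanish R k _ K^o _ (fun x => (U x n : K) - dotv (S x) (f n))
    (1 + `|C| * rnorm (f n)) _ _ _ _ Dx).
  - move=> b c; rewrite !linearB dotvBl [(U b - U c) n]/(U b n - U c n : K).
    by rewrite opprD addrACA -opprD.
  - move=> b; apply: le_trans (rnorm_leD _ _) _; rewrite rnormN mulrDl mul1r.
    apply: lerD (le_trans (l2_coord_le _ n) (U1 b)) _.
    apply: le_trans (cauchy_schwarz _ _) _.
    rewrite mulrAC ler_wpM2r ?rnorm_ge0//; apply: le_trans (SC b I) _.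
    by rewrite ler_wpM2r ?rnorm_ge0 ?ler_norm.
  - move=> _ [_ [z [-> _]]]; rewrite (UG (S z) (T' z)); last by exists z.
    by rewrite SS (Mcoeffs _ (MT' z)) subrr.
exists T, T', S; split => //; first by exists L => x _; exact: TL.
  split=> //; split=> // x Dx.
  have -> : (fun n => dotv x ((S \o f) n)) = fun n => dotv (S x) (f n).
    by apply/funext => n; rewrite Ssa.
  rewrite (coeffs_sqsum (Ucoeffs x Dx)); congr (_%:E).
  by rewrite -!res_dotvv Uiso//; exact: domG.
split=> // x /DT[a _ <-].
have [||w _ wP] := @riesz_relation R k H
  (fun v g => exists y, v = S y /\ g = dotv y (T a)) (rnorm a).
- split=> [|c _ _ _ _ [y [-> ->]] [y' [-> ->]]].
    by exists 0; rewrite linear0 dotv0l.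
  by exists (c *: y + y'); rewrite linearP dotvDl dotvZl.
- move=> _ _ [y [-> ->]]; rewrite rnorm_dotvC TT' -rST; exact: cauchy_schwarz.
exists w; apply: dotv_ext => y.
by rewrite -Ssa -(wP (S y) (dotv y (T a)))//; exists y.
Qed.

End Analysis.

(** * Convertible sequences and lower bounds *)

Section Equivalences.
Variables (R : realType) (k : scalar_kind) (H : hilbertType R k) (f : nat -> H).
Local Notation K := (scalar R k).
Local Notation l2 := (l2 R k).

Lemma bounded_onT (V W : normedModType K) (B : V -> W) :
  bounded_on setT B ->
  exists2 L : R, 0 <= L & forall x, rnorm (B x) <= L * rnorm x.
Proof.
move=> [L BL]; exists `|L| => // x; apply: le_trans (BL x I) _.
by rewrite ler_wpM2r ?rnorm_ge0 ?ler_norm.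
Qed.

Lemma adjointC (V W : preHilbertType R k) (B : V -> W) (B' : W -> V) :
  (forall x y, dotv (B x) y = dotv x (B' y)) ->
  forall x y, dotv (B' x) y = dotv x (B y).
Proof. by move=> BB' x y; rewrite dotv_conj -BB' -dotv_conj. Qed.

Lemma range_subspace (V W : normedModType K) (B : {linear V -> W}) :
  linear_subspace (range B).
Proof.
split; first by exists 0; rewrite ?linear0.
by move=> c _ _ [y _ <-] [y' _ <-]; exists (c *: y + y'); rewrite ?linearP.
Qed.

(** One implication of the closed range theorem: [|<B z, y>| <= |z| |B' y|]
    bounds [y] by [B' y] by uniform boundedness, and a limit [d] of the range of
    [B'] then defines a bounded functional [B z |-> <z, d>], represented by a
    preimage of [d]. *)
Lemma closed_range_adjoint (V W : hilbertType R k) (B : {linear V -> W})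
    (B' : {linear W -> V}) :
  (forall x y, dotv (B x) y = dotv x (B' y)) ->
  (forall y, exists x, B x = y) -> closed (range B').
Proof.
move=> BB' Bsurj.
have [|x|C C0 CP] := @weakly_bounded_relation R k V W (fun v y => v = B' y).
- split=> [|c _ y _ y' -> ->]; first by rewrite linear0.
  by rewrite linearP.
- have [z <-] := Bsurj x; exists (rnorm z) => _ y ->; rewrite BB'.
  exact: cauchy_schwarz.
rewrite closure_id eqEsubset; split; first exact: subset_closure.
move=> d cd.
have bd z : rnorm (dotv z d) <= C * rnorm (B z) * rnorm d.
  rewrite rnorm_dotvC; apply: dotv_closure_le cd.
    by rewrite mulr_ge0 ?rnorm_ge0.
  move=> _ [y _ <-]; rewrite (adjointC BB').
  apply: le_trans (cauchy_schwarz _ _) _.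
  by rewrite [leRHS]mulrAC ler_wpM2r ?rnorm_ge0// CP.
have [|v g [z [-> ->]]|w _ wP] := @riesz_relation R k W
  (fun v g => exists z, v = B z /\ g = dotv z d) (C * rnorm d).
- split=> [|c _ _ _ _ [y [-> ->]] [y' [-> ->]]].
    by exists 0; rewrite linear0 dotv0l.
  by exists (c *: y + y'); rewrite linearP dotvDl dotvZl.
- by rewrite mulrAC; exact: bd.
exists w => //; apply: dotv_ext => z; rewrite -BB' -(wP (B z) (dotv z d))//.
by exists z.
Qed.

(** The Parseval identity for [B f_n] says that the analysis operator of [f]
    composed with [B'] is an isometry. *)
Lemma parseval_adjoint_range (B B' : {linear H -> H}) (L : R) :
  infinite_dim [set: H] -> 0 <= L -> (forall x, rnorm (B x) <= L * rnorm x) ->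
  (forall x y, dotv (B x) y = dotv x (B' y)) ->
  parseval_frame setT (B \o f) -> has_lower_bound_on f (range B').
Proof.
move=> Hinf L0 BL BB' [_ pB]; have B'B := adjointC BB'.
have coef y : exists2 a, coeffs f (B' y) a & rnorm y = rnorm a.
  have e : (fun n => dotv y ((B \o f) n)) = fun n => dotv (B' y) (f n).
    by apply/funext => n; rewrite B'B.
  have := pB y I; rewrite e => yE.
  have [a ya] : exists a, coeffs f (B' y) a.
    by apply: coeffs_exists; rewrite /square_summable -yE ltry.
  exists a => //; move: yE; rewrite (coeffs_sqsum ya) => -[] /eqP.
  by rewrite eqrXn2 ?rnorm_ge0// => /eqP.
have inj y : B' y = 0 -> y = 0.
  move=> y0; have [a ya yE] := coef y; apply: (@rnorm0_eq0 R k).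
  by rewrite yE (coeffs_inj ya (b := 0)) ?rnorm0// y0; exact: coeffs0.
apply/lower_boundE; split; first exact: range_subspace.
  move=> [n [e [re eP]]]; apply: Hinf.
  have /choice[z zP] : forall i, exists z, B' z = e i.
    by move=> i; have [z _] := re i; exists z.
  exists n, z; split => // x _.
  have [c xc] := eP (B' x) (ex_intro2 _ _ x I erefl).
  exists c; apply/eqP; rewrite -subr_eq0; apply/eqP/inj.
  rewrite linearB xc linear_sum -sumrB big1// => i _.
  by rewrite linearZ/= zP subrr.
exists L => // _ [y _ <-]; have [a ya yE] := coef y; exists a => //.
by rewrite -yE; exact: (bounded_adjoint L0 BB' BL).
Qed.

Lemma parseval_pullback (E : set H) (S U U' : {linear H -> H}) :
  (forall x y, dotv (U x) y = dotv x (U' y)) ->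
  (forall x y, dotv (U x) (U y) = dotv x y) -> (forall x, E (U x)) ->
  parseval_frame E (S \o f) -> parseval_frame setT ((U' \o S) \o f).
Proof.
move=> UU' Uiso EU [_ pS]; split=> // x _.
rewrite -res_dotvv -Uiso res_dotvv (pS _ (EU x)); congr sqsum.
by apply/funext => n /=; rewrite UU'.
Qed.

(** [U] maps the whole space isometrically into the closure of [D], and [U']
    pulls the Parseval frame of the closure of [D] back along it. *)
Lemma lower_bound_CFC (D : set H) : separable H -> has_lower_bound_on f D ->
  CFC f /\ (closed D -> SCFC f).
Proof.
move=> Hsep DB; have [Dlin Dinf _] := DB.
have [T [T' [S [_ _ [[C SC] _ _ _] [_ pS] [DS _]]]]] := parseval_sqrt DB.
have Einf := infinite_dimS Dlin (@subset_closure _ D) Dinf.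
have [U [U' [UU' U1 Uiso EU]]] := separable_embedding Hsep
  (subspace_closure Dlin) (@closed_closure _ D) Einf.
have U'1 y : rnorm (U' y) <= rnorm y.
  rewrite -[leRHS]mul1r; apply: (bounded_adjoint ler01 UU') => x.
  by rewrite mul1r.
have bB : bounded_on setT (U' \o S).
  by exists C => x Dx; exact: le_trans (U'1 _) (SC x Dx).
have pB := parseval_pullback UU' Uiso EU pS.
split=> [|Dcl]; first by exists (U' \o S).
exists (U' \o S); split => // y.
have [|w wP] := DS (U y); first by rewrite ((closure_id D).1 Dcl); exact: EU.
by exists w; rewrite /= wP; apply: dotv_ext => z; rewrite -UU' Uiso.
Qed.

(** The square root of [parseval_sqrt] is itself the operator: its kernel is
    orthogonal to [D]. *)
Lemma dense_lower_bound_ICFC (D : set H) :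
  has_lower_bound_on f D -> closure D = setT -> ICFC f.
Proof.
move=> DB DT.
have [T [T' [S [_ _ [SC _ _ _] [_ pS] [_ S0]]]]] := parseval_sqrt DB.
exists S; split; [by []|by rewrite -DT|move=> x y Sxy].
apply/eqP; rewrite -subr_eq0; apply/eqP.
apply: (@dotv_closure_eq0 R k H D); first by rewrite DT.
by apply: S0; rewrite linearB Sxy subrr.
Qed.

(** Take for [D] the preimage of [M] orthogonal to the kernel of the analysis
    operator. The inverse from [M] to [D] has an adjoint [A], whose domain
    contains every [f n] because the coordinates are bounded on [M]. By uniform
    boundedness on [M], where [<m, u> = <x, y>] for [A y u] and [x] in [D] with
    coefficients [m], the adjoint is bounded, and then so is the inverse. *)
Lemma closed_range_lower_bound (M : set l2) : linear_subspace M -> closed M ->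
  infinite_dim M -> M `<=` analysis_range f ->
  exists D : set H, has_lower_bound_on f D.
Proof.
move=> Mlin Mcl Minf Mran; have [M0 MD] := Mlin.
pose N : set H := [set z | forall n, dotv z (f n) = 0].
have Nlin : linear_subspace N.
  split=> [n|c x y Nx Ny n]; first by rewrite dotv0l.
  by rewrite dotvDl dotvZl Nx Ny mulr0 addr0.
pose D : set H := [set x | (exists2 a, M a & coeffs f x a) /\
  forall z, N z -> dotv x z = 0].
have Dlin : linear_subspace D.
  split=> [|c x y [[a Ma xa] xN] [[b Mb yb] yN]]; split.
  - by exists 0 => //; exact: coeffs0.
  - by move=> z _; rewrite dotv0l.
  - by exists (c *: a + b); [exact: MD | exact: coeffs_linear].
  - by move=> z Nz; rewrite dotvDl dotvZl xN ?yN// mulr0 addr0.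
have onto a : M a -> exists2 x, D x & coeffs f x a.
  move=> Ma; have /analysis_rangeE[x xa] := Mran a Ma.
  have [w Nw xw] := orthogonal_projection x Nlin.
  have ca : coeffs f (x - w) a.
    move=> n; rewrite dotvBl (dotv_closure0 Nw) ?subr0; first exact: xa.
    by move=> d; apply.
  exists (x - w) => //; split; first by exists a.
  by move=> z Nz; rewrite dotv_conj xw// rmorph0.
exists D; apply/lower_boundE; split => //.
  move=> [n [e [De eP]]]; apply: Minf.
  have /choice[b bP] : forall i, exists b, M b /\ coeffs f (e i) b.
    by move=> i; have [[b Mb eb] _] := De i; exists b.
  exists n, b; split=> [i|a Ma]; first exact: (bP i).1.
  have [x Dx xa] := onto a Ma; have [c xc] := eP x Dx; exists c.
  apply: coeffs_inj xa _; rewrite xc.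
  elim/big_ind2: _ => [|y a' y' b' ya yb|i _]; first exact: coeffs0.
    by have := coeffs_linear 1 ya yb; rewrite !scale1r.
  by have := coeffs_linear (c i) (bP i).2 (coeffs0 f); rewrite !addr0.
pose A y u := M u /\ forall x a, D x -> coeffs f x a -> dotv x y = dotv a u.
have Alin : linear_relation A.
  split=> [|c y u y' u' [Mu yu] [Mu' yu']]; split => //.
  - by move=> x a _ _; rewrite !dotv0r.
  - exact: MD.
  - by move=> x a Dx xa; rewrite !dotvDr !dotvZr (yu x a)// (yu' x a).
have [a|L L0 LP] := weakly_bounded_relation Alin.
  have [m Mm am] := orthogonal_projection a Mlin.
  have [x Dx xm] := onto m ltac:(by rewrite ((closure_id M).1 Mcl)).
  exists (rnorm x) => y u [Mu yu].
  have -> : dotv a u = dotv x y.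
    rewrite (yu x m)//; apply/eqP; rewrite -subr_eq0 -dotvBl dotv_conj am//.
    by rewrite rmorph0.
  exact: cauchy_schwarz.
have Af n : rel_dom A (f n).
  have [|v g [_ ->]|u Mu uP] := @riesz_relation R k l2
    (fun a g => M a /\ g = a n) 1.
  - split=> // c v g v' g' [Mv ->] [Mv' ->]; split; first exact: MD.
    by rewrite l2_addE l2_scaleE.
  - by rewrite mul1r l2_coord_le.
  exists u; split.
    rewrite ((closure_id M).1 Mcl); apply: closureS Mu.
    by move=> b [g []].
  move=> x a [[b Mb xb] _] xa; rewrite -(uP a (a n)) ?xa//.
  by split=> //; rewrite (coeffs_inj xa xb).
exists L => // x Dx; have [[a Ma xa] xN] := Dx; exists a => //.
have Ax : closure (rel_dom A) x.
  apply: closure_orth => [|z Az]; first exact: rel_dom_subspace.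
  by apply: xN => n; rewrite dotv_conj Az ?rmorph0.
have La0 : 0 <= L * rnorm a by rewrite mulr_ge0 ?rnorm_ge0.
apply: (@rnorm_le_dotvv R k) => //; apply: dotv_closure_le Ax => //.
move=> y [u Ayu]; rewrite rnorm_dotvC (Ayu.2 x a)//.
apply: le_trans (cauchy_schwarz _ _) _.
by rewrite [leLHS]mulrC [leRHS]mulrAC ler_wpM2r ?rnorm_ge0 ?(LP y).
Qed.

End Equivalences.

Unset Implicit Arguments.

Theorem theorem3p2 (R : realType) (k : scalar_kind) (H : hilbertType R k)
    (f : nat -> H) (Hsep : separable H) (Hinf : infinite_dim [set: H]) :
  [/\
    (* (1) <-> (2) *)
    CFC f <->
      (exists M : set (l2 R k), [/\ linear_subspace M, closed M,
         infinite_dim M & M `<=` analysis_range f]),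
    (* (1) <-> (3) *)
    CFC f <-> (exists D : set H, has_lower_bound_on f D),
    (* (a) *)
    ((exists D : set H, has_lower_bound_on f D /\ closed D) -> SCFC f) /\
    (SCFC f -> exists D : set H, has_lower_bound_on f D /\ closed D),
    (* (b) *)
    ((exists D : set H, has_lower_bound_on f D /\ closure D = [set: H]) ->
       ICFC f) /\
    (ICFC f ->
       exists D : set H, has_lower_bound_on f D /\ closure D = [set: H])
    & (* (c) *)
    forall D : set H, has_lower_bound_on f D ->
      exists (C : set (l2 R k)) (T : l2 R k -> H) (T' : H -> l2 R k)
             (S : {linear H -> H}),
        [/\ linear_subspace C /\ closed C,
            linear_on C T /\ bounded_on C T,
            is_adjoint_on C T T',
            is_positive_sqrt S (T \o T')
          & (forall n, closure D (S (f n))) /\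
            parseval_frame (closure D) (S \o f)]].
Proof.
have to3 : CFC f -> exists D : set H, has_lower_bound_on f D.
  move=> [B [/bounded_onT[L L0 BL] pB]].
  have [B' BB'] := adjoint_exists L0 BL.
  by exists (range B'); exact: (parseval_adjoint_range Hinf L0 BL BB' pB).
split.
- split=> [/to3[D DB]|].
    have [T [T' [M [[Mlin Mcl Minf] _ _ [_ MT] _]]]] :=
      bounded_left_inverse DB.
    exists M; split=> // a Ma; apply/analysis_rangeE.
    by exists (T a); exact: MT.
  move=> [M [Mlin Mcl Minf Mran]].
  have [D DB] := closed_range_lower_bound Mlin Mcl Minf Mran.
  exact: (lower_bound_CFC Hsep DB).1.
- split=> [//|[D DB]]; exact: (lower_bound_CFC Hsep DB).1.
- split=> [[D [DB Dcl]]|]; first exact: (lower_bound_CFC Hsep DB).2 Dcl.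
  move=> [B [/bounded_onT[L L0 BL] pB Bsurj]].
  have [B' BB'] := adjoint_exists L0 BL.
  exists (range B'); split.
    exact: (parseval_adjoint_range Hinf L0 BL BB' pB).
  exact: closed_range_adjoint BB' Bsurj.
- split=> [[D [DB DT]]|]; first exact: dense_lower_bound_ICFC DB DT.
  move=> [B [/bounded_onT[L L0 BL] pB Binj]].
  have [B' BB'] := adjoint_exists L0 BL.
  exists (range B'); split.
    exact: (parseval_adjoint_range Hinf L0 BL BB' pB).
  apply/seteqP; split=> // x _.
  apply: closure_orth; first exact: range_subspace.
  move=> z zB'; rewrite (_ : z = 0) ?dotv0r//; apply: Binj; rewrite linear0.
  by apply: dotvv_eq0; rewrite BB' dotv_conj zB' ?rmorph0.
- move=> D DB; have [T [T' [S [bT TT' SP [SD pS] _]]]] := parseval_sqrt DB.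
  (* [T] is defined on all of [l2], which serves as the closed subspace. *)
  exists setT, T, T', S; split => //.
  by split=> [a x y _ _|]; [rewrite [LHS]linearP | exact: bT].
Qed.
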